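(* Let $\mu\in ID(\mathbb{R})$ satisfy $\mu((-\infty,0))=0$ and not be a Dirac measure. Then $\Phi_\mu$ is one-to-one on $\mathfrak{M}^1_L(\mathbb{R}^+)$, and $\Phi_\mu(\mathfrak{M}^1_L(\mathbb{R}^+))\subsetneq\mathfrak{M}^1_L(\mathbb{R}^+)$.
   Context: For $\mu\in ID(\mathbb{R})$ with characteristic exponent $\phi$, $\mu^s$ is the law with characteristic function $e^{s\phi}$. $\mathfrak{M}^1_L(\mathbb{R}^+)$ is the set of measures $\rho$ on $[0,\infty)$ with $\rho(\{0\})=0$ and $\int(1\wedge s)\rho(ds)<\infty$. $\Phi_\mu(\rho)$ is the measure with $\Phi_\mu(\rho)(\{0\})=0$ and $\Phi_\mu(\rho)(A)=\int_0^\infty\mu^s(A)\rho(ds)$ for Borel $A\subseteq\mathbb{R}\setminus\{0\}$ (when $\mu$ is supported on $[0,\infty)$, $\Phi_\mu(\rho)$ is a measure on $(0,\infty)$). *)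

(* Defs.v *)
From HB Require Import structures.
From mathcomp Require Import all_boot all_order all_algebra.
From mathcomp Require Import all_classical all_reals all_analysis.
Set Implicit Arguments. Unset Strict Implicit. Unset Printing Implicit Defensive.
Import Order.TTheory GRing.Theory Num.Theory.
Import numFieldNormedType.Exports.
Local Open Scope classical_set_scope.
Local Open Scope ring_scope.
Local Open Scope ereal_scope.

(* Measures on R are Borel measures (the canonical measurable structure on a
   realType is generated by intervals). *)

Fixpoint convpow (R : realType) (nu : {measure set R -> \bar R}) (n : nat)
  : set R -> \bar R :=
  match n with
  | O => fun A => \d_(0%R : R) A
  | S n' => fun A => \int[nu]_x convpow nu n' [set y | A (x + y)%R]
  end.

Definition infinitely_divisible (R : realType) (mu : probability R R) : Prop :=
  forall n : nat, (0 < n)%N ->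
    exists nu : probability R R,
      forall A : set R, measurable A -> convpow nu n A = mu A.

Definition is_dirac (R : realType) (mu : probability R R) : Prop :=
  exists a : R, forall A : set R, measurable A -> mu A = \d_a A.

(* The characteristic function of mu at t is
     \int cos(tx) mu(dx) + i \int sin(tx) mu(dx).
   A complex number z = re + i im is written as the pair of its real and
   imaginary parts.  [char_exponent mu a b] says that phi := a + i b is the
   characteristic exponent of mu: phi is continuous, phi(0) = 0 and
   exp(phi(t)) = characteristic function of mu at t, where
   exp(a + i b) = e^a (cos b + i sin b). *)
Definition char_exponent (R : realType) (mu : probability R R) (a b : R -> R)
  : Prop :=
  [/\ continuous a, continuous b, a 0%R = 0%R, b 0%R = 0%R &
    forall t : R,
      \int[mu]_x (cos (t * x))%:E = (expR (a t) * cos (b t))%:E /\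
      \int[mu]_x (sin (t * x))%:E = (expR (a t) * sin (b t))%:E].

(* [is_power a b s nu]: nu is the law with characteristic function
   exp(s phi), phi = a + i b. *)
Definition is_power (R : realType) (a b : R -> R) (s : R) (nu : probability R R)
  : Prop :=
  forall t : R,
    \int[nu]_x (cos (t * x))%:E = (expR (s * a t) * cos (s * b t))%:E /\
    \int[nu]_x (sin (t * x))%:E = (expR (s * a t) * sin (s * b t))%:E.

(* M^1_L(R^+): measures on [0,oo) (represented as Borel measures on R
   vanishing on (-oo,0)) with rho({0}) = 0 and \int (1 /\ s) rho(ds) < oo. *)
Definition ML (R : realType) (rho : {measure set R -> \bar R}) : Prop :=
  [/\ rho [set x | (x < 0)%R] = 0,
      rho [set 0%R] = 0 &
      \int[rho]_(x in [set x | (0 <= x)%R]) (Order.min 1 x)%:E < +oo].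

(* Phi_mu(rho)(A) = \int_(0,oo) mu^s(A \ {0}) rho(ds), where pw s = mu^s. *)
Definition Phi (R : realType) (pw : R -> probability R R)
  (rho : {measure set R -> \bar R}) : set R -> \bar R :=
  fun A => \int[rho]_(s in [set s | (0 < s)%R]) pw s (A `\ 0%R).

(* Main.v *)
(* Write X_s for a variable of law mu^s.  A class of bounded functions that is
   linear and closed under bounded pointwise limits and contains all cos (t x)
   and sin (t x) contains all bounded Borel functions; this yields the uniqueness
   theorem for characteristic functions, the convolution identity
   mu^s * mu^t = mu^(s+t), and the measurability of s |-> mu^s(A).
   As mu = mu^1 lives on [0, oo), so does mu^s for rational s, and then for all
   s because X_r is close to 0 for small r.  Hence E exp (- l X_s) is
   multiplicative in s with values in (0, 1], so it equals exp (- s psi(l)), and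
     \int (1 - exp (- l x)) Phi(rho)(dx) = f_rho(psi(l)),
   where f_rho(u) = \int (1 - exp (- u s)) rho(ds).
   The bound 1 /\ x <= 2 (1 - exp (- x)) gives Phi(rho) \in M_L^1.
   Since psi is continuous, psi(0) = 0 and psi > 0 on (0, oo), Phi(rho)
   determines f_rho on an interval [0, u0], hence everywhere by analytic
   continuation, hence rho.
   Finally the Dirac mass at 1 is not in the range: otherwise some X_s takes
   values in {0, 1}, so its independent halves take values in {0, 1/2} and are
   constant, which forces mu to be a Dirac measure. *)
Require Import Defs.
From HB Require Import structures.
From mathcomp Require Import all_boot all_order all_algebra.
From mathcomp Require Import all_classical all_reals all_analysis.
From mathcomp Require Import measurable_realfun ring lra.
Set Implicit Arguments. Unset Strict Implicit. Unset Printing Implicit Defensive.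
Import Order.TTheory GRing.Theory Num.Theory.
Import numFieldNormedType.Exports.
Local Open Scope classical_set_scope.
Local Open Scope ring_scope.

(** * Classes of functions closed under linear combinations and bounded pointwise limits *)

Section bounded_pointwise_classes.
Context {R : realType}.
Implicit Types (Q : (R -> R) -> Prop) (f g u : R -> R).

(** Measurability is not part of the closure conditions; the predicates [Q] used below carry it
    themselves. *)
Record bp_class Q : Prop := BpClass {
  bp_lin : forall k f g, Q f -> Q g -> Q (fun x => k * f x + g x);
  bp_lim : forall (f_ : nat -> R -> R) g M, (forall n, Q (f_ n)) ->
    (forall n x, `|f_ n x| <= M) -> (forall x, f_ ^~ x @ \oo --> g x) -> Q g }.

Lemma bp_ext Q f g : Q f -> f =1 g -> Q g.
Proof. by move=> Qf /funext <-. Qed.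

Lemma bp_scale Q k f : bp_class Q -> Q f -> Q (fun x => k * f x).
Proof.
move=> bQ Qf; apply: (bp_ext (bp_lin bQ (k - 1) Qf Qf)) => x; ring.
Qed.

Lemma bp_add Q f g : bp_class Q -> Q f -> Q g -> Q (fun x => f x + g x).
Proof. by move=> bQ Qf Qg; apply: (bp_ext (bp_lin bQ 1 Qf Qg)) => x; ring. Qed.

Lemma bp_sub Q f g : bp_class Q -> Q f -> Q g -> Q (fun x => f x - g x).
Proof.
by move=> bQ Qf Qg; apply: (bp_ext (bp_lin bQ (-1) Qg Qf)) => x; ring.
Qed.

Lemma bp_sum Q (I : Type) (r : seq I) (F : I -> R -> R) f0 : bp_class Q ->
  Q f0 -> (forall i, Q (F i)) -> Q (fun x => \sum_(i <- r) F i x).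
Proof.
move=> bQ Qf0 QF; elim: r => [|i r IH].
  by apply: (bp_ext (bp_scale 0 bQ Qf0)) => x; rewrite big_nil mul0r.
by apply: (bp_ext (bp_add bQ (QF i) IH)) => x; rewrite big_cons.
Qed.

Lemma bp_poly Q u (p : {poly R}) : bp_class Q ->
  (forall k, Q (fun x => u x ^+ k)) -> Q (fun x => p.[u x]).
Proof.
move=> bQ Qu.
apply: (bp_ext (f := fun x => \sum_(i < size p) p`_i * u x ^+ i)).
  by apply: (bp_sum _ bQ (Qu 0%N)) => i; exact: bp_scale.
by move=> x; rewrite horner_coef.
Qed.

(** Bernoulli's inequality, by induction on [n]. *)
Lemma ler1_Mexpr (x : R) n : -1 <= x -> 1 + n%:R * x <= (1 + x) ^+ n.
Proof.
move=> x1; elim: n => [|n IH]; first by rewrite mul0r addr0 expr0.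
have x0 : 0 <= 1 + x by lra.
rewrite exprS; apply: le_trans (ler_wpM2l x0 IH).
have := sqr_ge0 x; have : 0 <= n%:R :> R by [].
rewrite -natr1 expr2; nra.
Qed.

(* The exponent [2 ^ n] puts the threshold of [(1 - v ^ n) ^ (2 ^ n)] at
   [v = 1/2], i.e. [y = 0]; the first factor kills the value at [y = 0]. *)
Definition step_poly (n : nat) : {poly R} :=
  (1 - (1 - 'X ^+ 2) ^+ n) * (1 - (2^-1 *: (1 - 'X)) ^+ n) ^+ (2 ^ n).

Lemma horner_step n y : (step_poly n).[y] =
  (1 - (1 - y ^+ 2) ^+ n) * (1 - ((1 - y) / 2) ^+ n) ^+ (2 ^ n).
Proof. by rewrite /step_poly !hornerE [2^-1 * _]mulrC. Qed.

Lemma step_poly_itv n y : `|y| <= 1 -> 0 <= (step_poly n).[y] <= 1.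
Proof.
rewrite ler_norml horner_step => /andP[y1 y2].
have h1 : 0 <= (1 - y ^+ 2) ^+ n <= 1.
  by rewrite exprn_ge0 ?exprn_ile1//; rewrite ?expr2; nra.
have h2 : 0 <= ((1 - y) / 2) ^+ n <= 1.
  by rewrite exprn_ge0 ?exprn_ile1//; lra.
have h3 : 0 <= (1 - ((1 - y) / 2) ^+ n) ^+ (2 ^ n) <= 1.
  by rewrite exprn_ge0 ?exprn_ile1//; lra.
move: h1 h3 => /andP[? ?] /andP[? ?].
by rewrite mulr_ge0 ?mulr_ile1//; lra.
Qed.

Lemma expr_half_exp (v : R) n : 2 ^+ n * (v / 2) ^+ n = v ^+ n.
Proof. by rewrite -exprMn; congr (_ ^+ _); field. Qed.

(** Put [v = ((1 - y) / 2) ^ n], so that [2 ^ n * v = (1 - y) ^ n]. For [y > 0], Bernoulli bounds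
    the second factor below by [1 - (1 - y) ^ n], which tends to 1. For [y < 0],
    [(1 - v) (1 + v) <= 1] and Bernoulli for [1 + v] bound it above by [(1 - y) ^ (- n)], which
    tends to 0. *)
Lemma cvg_step_poly y : `|y| <= 1 ->
  (fun n => (step_poly n).[y]) @ \oo --> ((0 < y)%R%:R : R).
Proof.
move=> y1; have := y1; rewrite ler_norml => /andP[ym yp].
case: (ltgtP 0 y) => y0.
- have lim0 : (fun n : nat => (1 - y ^+ 2) ^+ n) @ \oo --> (0 : R).
    by apply: cvg_expr; rewrite ger0_norm expr2; nra.
  have lim1 : (fun n : nat => (1 - y) ^+ n) @ \oo --> (0 : R).
    by apply: cvg_expr; rewrite ger0_norm; lra.
  have lim2 : (fun n : nat => (1 - ((1 - y) / 2) ^+ n) ^+ (2 ^ n)) @ \oo --> (1 : R).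
    apply: (@squeeze_cvgr _ _ _ _ (fun n => 1 - (1 - y) ^+ n) (fun=> 1)).
    + near=> n.
      have h2 : 0 <= ((1 - y) / 2) ^+ n <= 1.
        by rewrite exprn_ge0 ?exprn_ile1//; lra.
      apply/andP; split; last by rewrite exprn_ile1//; lra.
      have := @ler1_Mexpr (- ((1 - y) / 2) ^+ n) (2 ^ n).
      by rewrite mulrN natrX expr_half_exp; apply; lra.
    + by have := cvgB (cvg_cst (1 : R)) lim1; rewrite subr0; exact.
    + exact: cvg_cst.
  under eq_fun do rewrite horner_step.
  by have := cvgM (cvgB (cvg_cst (1 : R)) lim0) lim2; rewrite subr0 mulr1; exact.
- have lim : (fun n : nat => (1 - y)^-1 ^+ n) @ \oo --> (0 : R).
    apply: cvg_expr; rewrite ger0_norm ?invr_ge0; last lra.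
    by rewrite invf_lt1; lra.
  apply: (@squeeze_cvgr _ _ _ _ (fun=> 0) (fun n => (1 - y)^-1 ^+ n)) => //;
    last exact: cvg_cst.
  near=> n.
  have /andP[-> _] := step_poly_itv n y1; rewrite /= horner_step.
  set v := ((1 - y) / 2) ^+ n.
  have v1 : 0 <= v <= 1 by rewrite exprn_ge0 ?exprn_ile1//; lra.
  have e2 : 2 ^+ n * v = (1 - y) ^+ n by rewrite expr_half_exp.
  have h3 : 0 <= (1 - v) ^+ (2 ^ n) by rewrite exprn_ge0; lra.
  have h1 : 0 <= (1 - y ^+ 2) ^+ n <= 1.
    by rewrite exprn_ge0 ?exprn_ile1//; rewrite ?expr2; nra.
  apply: (@le_trans _ _ ((1 - v) ^+ (2 ^ n))).
    by rewrite ler_piMl//; lra.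
  have p0 : 0 < (1 - y) ^+ n by rewrite exprn_gt0; lra.
  rewrite exprVn -[leRHS]mul1r ler_pdivlMr// -e2.
  apply: (@le_trans _ _ ((1 - v) ^+ (2 ^ n) * (1 + v) ^+ (2 ^ n))).
    apply: ler_wpM2l => //; rewrite -natrX.
    by have := @ler1_Mexpr v (2 ^ n); lra.
  by rewrite -exprMn exprn_ile1//; nra.
- rewrite -y0; under eq_fun do
    rewrite horner_step expr2 mulr0 subr0 expr1n subrr mul0r.
  exact: cvg_cst.
Unshelve. all: by end_near. Qed.

(** The step polynomials, translated by [c] and evaluated at [u], are combinations of powers of [u]
    that converge boundedly to this indicator. *)
Lemma bp_gt Q u c : bp_class Q -> (forall k, Q (fun x => u x ^+ k)) ->
  (forall x, `|u x - c| <= 1) -> Q (fun x => (c < u x)%R%:R).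
Proof.
move=> bQ Qu u1.
apply: (bp_lim (f_ := fun n x => (step_poly n \Po ('X - c%:P)).[u x]) (M := 1) bQ).
- by move=> n; exact: bp_poly.
- move=> n x; rewrite horner_comp hornerXsubC.
  by have /andP[? ?] := step_poly_itv n (u1 x); rewrite ger0_norm.
- move=> x; under eq_fun do rewrite horner_comp hornerXsubC.
  by rewrite -subr_gt0; exact: cvg_step_poly.
Qed.

Definition bounded_measurable g :=
  measurable_fun [set: R] g /\ exists M : R, forall x, `|g x| <= M.

(** By disjointness the partial sums of the indicators are indicators of finite unions, so they are
    bounded by 1 and eventually constant at each point. *)
Lemma bp_bigcup Q (F : nat -> set R) : bp_class Q -> trivIset setT F ->
  (forall n, Q \1_(F n)) -> Q \1_(\bigcup_k F k).
Proof.
move=> bQ tF QF.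
have sumE n x : \sum_(k < n) \1_(F k) x = \1_(\bigcup_(k in `I_n) F k) x :> R.
  have [[k kn Fkx]|nF] := pselect ((\bigcup_(k in `I_n) F k) x).
    rewrite indicE mem_set; last by exists k.
    rewrite (bigD1 (Ordinal kn))//= indicE mem_set// big1 ?addr0// => i.
    move=> /eqP ik; rewrite indicE memNset// => Fix.
    apply: ik; apply: val_inj => /=.
    by apply: (tF i k) => //; exists x.
  rewrite indicE memNset// big1// => i _.
  rewrite indicE memNset// => Fix; apply: nF; exists i => //=; exact: ltn_ord.
apply: (@bp_lim Q bQ (fun n x => \sum_(k < n) \1_(F k) x) _ 1).
- by move=> n; exact: (bp_sum _ bQ (QF 0%N)).
- by move=> n x; rewrite sumE indicE normr_nat lern1 leq_b1.
- move=> x; under eq_fun do rewrite sumE.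
  apply: cvg_near_cst.
  have [[k _ Fkx]|nF] := pselect ((\bigcup_k F k) x).
    near=> n; rewrite !indicE !mem_set//; first by exists k.
    by exists k => //=; near: n; exact: nbhs_infty_gt.
  near=> n; rewrite !indicE !memNset// => -[k _ Fkx]; apply: nF; by exists k.
Unshelve. all: by end_near. Qed.

(** Dynkin's pi-lambda theorem: open right rays are stable under intersection and generate the Borel
    sets. *)
Lemma bp_indic Q (A : set R) : bp_class Q ->
  (forall a : R, Q \1_`]a, +oo[) -> measurable A -> Q \1_A.
Proof.
move=> bQ Qray mA.
have Q1 : Q \1_[set: R].
  apply: (@bp_lim Q bQ (fun n => \1_(`](- n%:R)%R, +oo[)) _ 1).
  - by move=> n; exact: Qray.
  - by move=> n x; rewrite indicE normr_nat lern1 leq_b1.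
  - move=> x; apply: cvg_near_cst; near=> n.
    rewrite !indicE !mem_set//= in_itv/= andbT ltrNl.
    near: n; exact: nbhs_infty_gtr.
have GE := @RGenOInfty.measurableE R.
apply: (@dynkin_induction _ (measurableTypeR R) (@RGenOInfty.G R)
  (fun A => Q \1_A)) => //.
- move=> _ _ [x ->] [y ->]; exists (Num.max x y).
  apply/seteqP; split => z /=; rewrite !in_itv/= !andbT gt_max.
    by move=> [-> ->].
  by move=> /andP[].
- by move=> _ [x ->].
- move=> S mS QS; apply: (bp_ext (bp_sub bQ Q1 QS)) => x.
  by rewrite indicC indicE in_setT indicE; case: (x \in S); rewrite ?subrr ?subr0.
- by move=> F mF tF QF; exact: bp_bigcup.
- by have : (@ocitv R).-sigma.-measurable A by []; rewrite GE.
Unshelve. all: by end_near. Qed.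

Import HBNNSimple.

(** Adding the bound [M] makes the function nonnegative, hence an increasing limit of simple
    functions bounded by [2 M]; the constant [M] is subtracted at the end. *)
Lemma bp_bounded_measurable Q g : bp_class Q ->
  (forall a : R, Q \1_`]a, +oo[) -> bounded_measurable g -> Q g.
Proof.
move=> bQ Qray [mg [M gM]].
have Qind A := bp_indic (A := A) bQ Qray.
have mh : measurable_fun [set: R] (EFin \o (fun x => g x + M)).
  by apply/measurable_EFinP; apply: measurable_funD.
have h0 x : 0 <= g x + M by have := gM x; rewrite ler_norml => /andP[]; lra.
pose h_ := nnsfun_approx measurableT mh.
have Qh : Q (fun x => g x + M).
  apply: (bp_lim (f_ := fun n x => h_ n x) (M := M + M) bQ).
  - move=> n.
    have hE : (fun x => \sum_(y <- finmap.enum_fset (fset_set (range (h_ n))))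
        (y * \1_(h_ n @^-1` [set y]) x)) =1 h_ n.
      by move=> x; rewrite [RHS]fimfunE fsbig_finite.
    apply: (@bp_ext Q _ _ _ hE).
    apply: (bp_sum _ bQ (Qind _ measurable0)) => y; apply: bp_scale => //.
    by apply: Qind; exact: measurable_sfunP.
  - move=> n x; rewrite ger0_norm//.
    have : h_ n x <= g x + M.
      rewrite -lee_fin /h_ nnsfun_approxE.
      apply: (le_approx (D := setT) (f := EFin \o (fun x => g x + M))) => // y _.
      by rewrite lee_fin.
    by have := gM x; rewrite ler_norml => /andP[]; lra.
  - move=> x.
    have hc := @cvg_nnsfun_approx _ _ _ _ measurableT _ mh (fun x _ => h0 x) x I.
    by move/fine_cvgP : hc => [].
have Q1 := Qind setT measurableT.
apply: (bp_ext (bp_sub bQ Qh (bp_scale M bQ Q1))) => x.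
by rewrite indicE in_setT mulr1 addrK.
Qed.

End bounded_pointwise_classes.

(** * Trigonometric functions generate all bounded Borel functions *)

Section trigonometric_generation.
Context {R : realType} (Q : (R -> R) -> Prop) (bQ : bp_class Q).
Hypothesis Qcos : forall t, Q (fun x => cos (t * x)).
Hypothesis Qsin : forall t, Q (fun x => sin (t * x)).

(** Induction on [k] with [sin A cos B = (sin (A + B) + sin (A - B)) / 2]; each sine is a cosine
    shifted by [pi / 2], which is why the phase [d] and frequency [c] are arbitrary. *)
Lemma bp_sin_expr_cos k (t e c d : R) :
  Q (fun x => sin (t * x + e) ^+ k * cos (c * x + d)).
Proof.
elim: k c d => [|k IH] c d.
  apply: (bp_ext (bp_sub bQ (bp_scale (cos d) bQ (Qcos c))
    (bp_scale (sin d) bQ (Qsin c)))) => x.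
  by rewrite expr0 mul1r cosD; ring.
have H1 := IH (t + c) (e + d - pi / 2).
have H2 := IH (t - c) (e - d - pi / 2).
apply: (bp_ext (bp_scale 2^-1 bQ (bp_add bQ H1 H2))) => x.
have -> : (t + c) * x + (e + d - pi / 2) = (t * x + e) + (c * x + d) - pi / 2.
  by ring.
have -> : (t - c) * x + (e - d - pi / 2) = (t * x + e) - (c * x + d) - pi / 2.
  by ring.
rewrite !cosBpihalf (sinD (t * x + e)) (sinB (t * x + e)) exprS.
by field.
Qed.

(** For fixed [x] and large [n], [(x - a) / (n + 1)] lies in [(- pi, pi)], where the sine has the
    sign of its argument. So the indicators of [0 < sin ((x - a) / (n + 1))] converge to that of the
    ray. *)
Lemma trig_ray a : Q \1_`]a, +oo[.
Proof.
have Qgt n : Q (fun x => (0 < sin (n.+1%:R^-1 * x - n.+1%:R^-1 * a))%R%:R).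
  apply: (bp_gt bQ) => [k|x]; last first.
    by rewrite subr0 ler_norml sin_geN1 sin_le1.
  apply: (bp_ext (bp_sin_expr_cos k n.+1%:R^-1 (- (n.+1%:R^-1 * a)) 0 0)) => x.
  by rewrite mul0r addr0 cos0 mulr1.
apply: (@bp_lim _ Q bQ _ _ 1 Qgt) => [n x|x].
  by rewrite normr_nat lern1 leq_b1.
apply: cvg_near_cst.
have sin_small (y : R) : 0 < y -> \forall n \near \oo, 0 < sin (n.+1%:R^-1 * y).
  move=> y0; near=> n; apply: sin_gt0_pi.
  rewrite mulr_gt0//= ltr_pdivrMl// -ltr_pdivrMr ?pi_gt0//.
  apply: (@lt_trans _ _ n%:R); last by rewrite ltr_nat.
  near: n; exact: nbhs_infty_gtr.
rewrite indicE; case: (ltgtP a x) => ax.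
- near=> n; rewrite mem_set /= ?in_itv/= ?ax//.
  rewrite -mulrBr (_ : (0 < _) = true)//.
  by near: n; apply: sin_small; lra.
- near=> n; rewrite memNset /= ?in_itv/= ?andbT; last first.
    by apply/negP; rewrite -leNgt ltW.
  rewrite -mulrBr -opprB mulrN sinN oppr_gt0.
  rewrite (_ : (_ < 0) = false)//.
  apply/negbTE; rewrite -leNgt ltW//.
  by near: n; apply: sin_small; lra.
- near=> n; rewrite memNset /= ?in_itv/= ?ax ?ltxx//.
  by rewrite subrr sin0 ltxx.
Unshelve. all: by end_near. Qed.

End trigonometric_generation.

(** * Exponentials generate indicators of rays, starting from a bounded interval of exponents *)

Section exponential_generation.
Context {R : realType} (Q : (R -> R) -> Prop) (bQ : bp_class Q).
Implicit Types (d l m h x : R).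

(** With the positive part, [exp (- l x)] becomes bounded on the whole line for [l >= 0], without
    change on [[0, oo)], where the relevant measures live. *)
Definition ppart (x : R) := Num.max x 0.

Lemma ppart_ge0 x : 0 <= ppart x.
Proof. by rewrite /ppart le_max lexx orbT. Qed.

Lemma ppart_id x : 0 <= x -> ppart x = x.
Proof. by move=> x0; apply/max_idPl. Qed.

Definition has_exp l := Q (fun x => expR (- (l * ppart x))).

(** This is an [n]-fold finite difference in the exponent with step [e]; the exponents involved run
    from [m] to [m + n e] and stay in [[0, d]]. *)
Lemma has_exp_difference d m e n : 0 <= m -> 0 <= e -> m + n%:R * e <= d ->
  (forall l, 0 <= l <= d -> has_exp l) ->
  Q (fun x => (1 - expR (- (e * ppart x))) ^+ n * expR (- (m * ppart x))).
Proof.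
move=> m0 e0 + Qd; elim: n m m0 => [|n IH] m m0 mn.
  apply: (@bp_ext _ Q _ _ (Qd m _)); first by rewrite m0; lra.
  by move=> x; rewrite expr0 mul1r.
have n0 : 0 <= n%:R :> R by [].
rewrite -natr1 in mn.
have H1 := IH m m0 ltac:(nra); have H2 := IH (m + e) ltac:(lra) ltac:(nra).
apply: (bp_ext (bp_sub bQ H1 H2)) => x.
have -> : - ((m + e) * ppart x) = - (e * ppart x) + - (m * ppart x) by ring.
by rewrite expRD exprS; ring.
Qed.

Lemma onemexp_itv (e p : R) : 0 < e -> 0 <= p ->
  p - e * p ^+ 2 <= (1 - expR (- (e * p))) / e <= p.
Proof.
move=> e0 p0; have ep0 : 0 <= e * p by nra.
have h1 := expR_ge1Dx (- (e * p)).
have h2 := expR_ge1Dx (e * p).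
have h3 := expRxMexpNx_1 (e * p).
have h4 := expR_gt0 (- (e * p)).
rewrite ler_pdivlMr// ler_pdivrMr// expr2.
set q := expR (- (e * p)) in h1 h3 h4 *.
set r := expR (e * p) in h2 h3.
have h5 : q * (1 + e * p) <= 1 by nra.
apply/andP; split; last by lra.
(* With [y = e p], this follows from [q <= 1 / (1 + y)] and
   [(1 - y + y ^ 2) (1 + y) = 1 + y ^ 3]. *)
suff : q <= 1 - e * p + (e * p) * (e * p) by lra.
rewrite -(ler_pM2r (_ : 0 < 1 + e * p)); last by lra.
apply: (le_trans h5).
have -> : (1 - e * p + e * p * (e * p)) * (1 + e * p) = 1 + e * p * (e * p) * (e * p).
  by ring.
by rewrite lerDl; do 2!(apply: mulr_ge0 => //).
Qed.

(** Up to sign this is the [n]-th derivative in the exponent at [m], a bounded limit of [n]-fold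
    difference quotients. *)
Lemma has_exp_monomial d m n : 0 < m < d ->
  (forall l, 0 <= l <= d -> has_exp l) ->
  Q (fun x => ppart x ^+ n * expR (- (m * ppart x))).
Proof.
move=> /andP[m0 md] Qd.
have [->|n0] := eqVneq n 0%N.
  apply: (@bp_ext _ Q _ _ (Qd m _)); first by apply/andP; split; lra.
  by move=> x; rewrite expr0 mul1r.
have n1 : 0 < n%:R :> R by rewrite ltr0n lt0n.
(* The step size tends to 0 and keeps [m + n * e k <= d]. *)
pose e k := (d - m) / n%:R / k.+1%:R.
have e0 k : 0 < e k by rewrite /e !divr_gt0//; lra.
pose f k (x : R) := ((1 - expR (- (e k * ppart x))) / e k) ^+ n * expR (- (m * ppart x)).
have f_itv k x : 0 <= f k x <= ppart x ^+ n * expR (- (m * ppart x)).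
  have p0 := ppart_ge0 x.
  have /andP[_ h1] := onemexp_itv (e0 k) p0.
  have h0 : 0 <= (1 - expR (- (e k * ppart x))) / e k.
    apply: divr_ge0; last exact: ltW.
    by rewrite subr_ge0 expR_le1 oppr_le0 mulr_ge0// ltW.
  rewrite /f mulr_ge0 ?expR_ge0 ?exprn_ge0//=.
  by rewrite ler_wpM2r ?expR_ge0// lerXn2r ?nnegrE.
(* The bound comes from [y ^ n / n! <= exp y] at [y = m * ppart x]. *)
apply: (@bp_lim _ Q bQ f _ (n`!%:R / m ^+ n)).
- move=> k; apply: (bp_ext (bp_scale ((e k)^-1 ^+ n) bQ
    (@has_exp_difference d m (e k) n _ _ _ Qd))); try exact: ltW.
    rewrite /e mulrA [n%:R * _]mulrC divfK ?gt_eqF//.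
    rewrite -lerBrDl.
    by rewrite ler_pdivrMr// ler_peMr ?ler1n//; lra.
  by move=> x; rewrite /f exprMn; ring.
- move=> k x; have /andP[f0 f1] := f_itv k x; rewrite ger0_norm//.
  apply: (le_trans f1).
  have mp : 0 <= m * ppart x by rewrite mulr_ge0 ?ppart_ge0// ltW.
  have := expR_ge1Dxn n.-1 mp; rewrite prednK ?lt0n// => hx.
  rewrite expRN ler_pdivlMr ?exprn_gt0// mulrAC ler_pdivrMr ?expR_gt0//.
  rewrite -exprMn [ppart x * m]mulrC [n`!%:R * _]mulrC -ler_pdivrMr ?ltr0n ?fact_gt0//.
  by apply: le_trans hx; lra.
- move=> x; apply: cvgM; last exact: cvg_cst.
  have p0 := ppart_ge0 x.
  suff : (fun k => (1 - expR (- (e k * ppart x))) / e k) @ \oo --> ppart x.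
    move=> h; apply: (cvg_comp _ (fun y : R => y ^+ n) h).
    exact: exprn_continuous.
  apply: (@squeeze_cvgr _ _ _ _ (fun k => ppart x - e k * ppart x ^+ 2)
    (fun=> ppart x)); last exact: cvg_cst.
    by near=> k; exact: onemexp_itv.
  have e_lim : e @ \oo --> (0 : R).
    have := cvgM (cvg_cst ((d - m) / n%:R : R)) (@cvg_harmonic R).
    by rewrite mulr0; exact.
  have := cvgB (cvg_cst (ppart x)) (cvgM e_lim (cvg_cst (ppart x ^+ 2))).
  by rewrite mul0r subr0; exact.
Unshelve. all: by end_near. Qed.

(** Expand [exp (- h p)] in its power series. The partial sums times [exp (- m p)] are bounded by
    [exp ((h - m) p) <= 1], and this is where [h <= m] enters. *)
Lemma has_exp_add d m h : 0 < m < d -> 0 <= h <= m ->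
  (forall l, 0 <= l <= d -> has_exp l) -> has_exp (m + h).
Proof.
move=> md /andP[h0 hm] Qd.
pose f N (x : R) := \sum_(0 <= n < N)
  ((- h) ^+ n / n`!%:R) * (ppart x ^+ n * expR (- (m * ppart x))).
have fE N x : f N x =
    series (exp_coeff (- (h * ppart x))) N * expR (- (m * ppart x)).
  rewrite /f /series/= big_distrl/=; apply: eq_bigr => n _.
  by rewrite /exp_coeff/= -(mulNr h) exprMn; ring.
apply: (@bp_lim _ Q bQ f _ 1).
- move=> N; rewrite /f.
  apply: (bp_sum _ bQ (has_exp_monomial 0 md Qd)) => n.
  by apply: bp_scale => //; exact: has_exp_monomial md Qd.
- move=> N x; have p0 := ppart_ge0 x.
  have hp : 0 <= h * ppart x by rewrite mulr_ge0.
  rewrite fE normrM [`|expR _|]ger0_norm ?expR_ge0//.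
  have le1 : `|series (exp_coeff (- (h * ppart x))) N| <= expR (h * ppart x).
    apply: (@le_trans _ _ (series (exp_coeff (h * ppart x)) N)).
      rewrite /series/=; apply: (le_trans (ler_norm_sum _ _ _)).
      apply: ler_sum => n _; rewrite /exp_coeff/= normrM normrX normrN.
      by rewrite (ger0_norm hp) ger0_norm.
    rewrite /expR; apply: nondecreasing_cvgn_le; last exact: is_cvg_series_exp_coeff.
    apply: nondecreasing_series => n _ _; exact: exp_coeff_ge0.
  apply: (le_trans (ler_wpM2r (expR_ge0 _) le1)).
  rewrite -expRD expR_le1 -mulrBl; nra.
- move=> x; under eq_fun do rewrite fE.
  have -> : - ((m + h) * ppart x) = - (h * ppart x) + - (m * ppart x) by ring.
  rewrite expRD; apply: cvgM; last exact: cvg_cst.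
  exact: is_cvg_series_exp_coeff.
Qed.

(* Analytic continuation of the Laplace transform: the exponential series
   around [m < d] reaches up to [2 m]. *)
Lemma has_exp_all d : 0 < d -> (forall l, 0 <= l <= d -> has_exp l) ->
  forall l, 0 <= l -> has_exp l.
Proof.
move=> d0 Qd.
have step k : forall l, 0 <= l <= d * (3 / 2) ^+ k -> has_exp l.
  elim: k => [|k IH] l; first by rewrite expr0 mulr1; exact: Qd.
  move=> /andP[l0]; rewrite exprS mulrCA => l1.
  set D := d * _ in IH l1.
  have D0 : 0 < D by rewrite mulr_gt0// exprn_gt0; lra.
  have [lD|Dl] := leP l D; first by apply: IH; rewrite l0.
  (* Centre and increment are both [l / 2], at most [3 D / 4] and so below [D]. *)
  have -> : l = l / 2 + l / 2 by field.
  by apply: has_exp_add IH; lra.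
move=> l l0.
(* By Bernoulli [(3 / 2) ^ k >= 1 + k / 2], so such a [k] is large enough. *)
have [k kl] : exists k : nat, l / d * 2 <= k%:R.
  exists (Num.bound (l / d * 2)); apply/ltW/archi_boundP.
  by rewrite mulr_ge0// divr_ge0// ltW.
apply: (step k); rewrite l0/= mulrC -ler_pdivrMr//.
have := @ler1_Mexpr R (1 / 2) k.
have -> : 1 + 1 / 2 = 3 / 2 :> R by field.
by move=> /(_ ltac:(lra)); lra.
Qed.

(** The ray is the set where [1 - exp (- ppart x)] exceeds [1 - exp (- a)], and powers of that
    function are combinations of exponentials with integer exponents. *)
Lemma exp_ray a : (forall k : nat, has_exp k%:R) -> 0 <= a -> Q \1_`]a, +oo[.
Proof.
move=> Qe a0.
have Qk k : Q (fun x => (1 - expR (- ppart x)) ^+ k).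
  apply: (@bp_ext _ Q (fun x => ((1 - 'X) ^+ k).[expR (- ppart x)])).
    apply: bp_poly => // j; apply: (bp_ext (Qe j)) => x.
    by rewrite -mulrN expRM_natl.
  by move=> x; rewrite !hornerE.
have e_itv (y : R) : 0 <= y -> 0 < expR (- y) <= 1.
  by move=> y0; rewrite expR_gt0 expR_le1 oppr_le0.
apply: (bp_ext (bp_gt (c := 1 - expR (- a)) bQ Qk _)) => x.
  have /andP[? ?] := e_itv _ (ppart_ge0 x); have /andP[? ?] := e_itv _ a0.
  by rewrite ler_norml; apply/andP; split; lra.
rewrite indicE ltrD2l ltrN2 ltr_expR ltrN2.
have -> : (x \in `]a, +oo[%classic) = (a < x).
  by apply/idP/idP; rewrite inE /= in_itv/= andbT.
rewrite /ppart lt_max; have [//|/= xa] := ltP a x.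
by rewrite ltNge a0.
Qed.

End exponential_generation.

(** * Functionals continuous under bounded pointwise convergence, and integrals as examples *)

Section bounded_pointwise_functionals.
Context {R : realType}.
Implicit Types (L : (R -> R) -> R) (f g : R -> R).

Record bp_functional L : Prop := BpFunctional {
  bpf_lin : forall k f g, bounded_measurable f -> bounded_measurable g ->
    L (fun x => k * f x + g x) = k * L f + L g;
  bpf_lim : forall (f_ : nat -> R -> R) g (M : R), (forall n, measurable_fun [set: R] (f_ n)) ->
    (forall n x, `|f_ n x| <= M) -> (forall x, f_ ^~ x @ \oo --> g x) ->
    L \o f_ @ \oo --> L g }.

Lemma bounded_measurable_lin k f g : bounded_measurable f ->
  bounded_measurable g -> bounded_measurable (fun x => k * f x + g x).
Proof.
move=> [mf [M fM]] [mg [N gN]]; split.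
  by apply: measurable_funD => //; exact: measurable_funM.
exists (`|k| * M + N) => x; apply: (le_trans (ler_normD _ _)).
by rewrite lerD// normrM ler_wpM2l.
Qed.

Lemma bounded_measurable_lim (f_ : nat -> R -> R) g (M : R) :
  (forall n, measurable_fun [set: R] (f_ n)) -> (forall n x, `|f_ n x| <= M) ->
  (forall x, f_ ^~ x @ \oo --> g x) -> bounded_measurable g.
Proof.
move=> mf fM fg; split.
  by apply: (measurable_fun_cvg (h := f_)) => // x _; exact: fg.
exists M => x.
have h : `|f_ n x| @[n --> \oo] --> `|g x|.
  by apply: cvg_norm; exact: fg.
rewrite -(cvg_lim _ h)//; apply: limr_le; first by apply/cvg_ex; exists `|g x|.
by near=> n; exact: fM.
Unshelve. all: by end_near. Qed.

Lemma bounded_measurable_cst (c : R) : bounded_measurable (fun=> c).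
Proof. by split; [exact: measurable_cst|exists `|c|]. Qed.

Lemma bounded_measurable_indic (A : set R) : measurable A ->
  bounded_measurable \1_A.
Proof.
move=> mA; split; first exact: measurable_indic.
by exists 1 => x; rewrite indicE normr_nat lern1 leq_b1.
Qed.

Lemma bpf_sub L f g : bp_functional L -> bounded_measurable f ->
  bounded_measurable g -> L (fun x => f x - g x) = L f - L g.
Proof.
move=> bL bf bg; have := bpf_lin bL (-1) bg bf.
rewrite (_ : (fun x => -1 * g x + f x) = (fun x => f x - g x)); last first.
  by apply/funext => x; ring.
by move=> ->; ring.
Qed.

(** Reduces equality of two functionals to a check on generating functions. *)
Lemma bp_class_eq L1 L2 : bp_functional L1 -> bp_functional L2 ->
  bp_class (fun g => bounded_measurable g /\ L1 g = L2 g).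
Proof.
move=> b1 b2; split=> [k f g [bf Lf] [bg Lg]|f_ g M fP fM fg].
  split; first exact: bounded_measurable_lin.
  by rewrite !bpf_lin// Lf Lg.
have mf n : measurable_fun [set: R] (f_ n) by have [[]] := fP n.
split; first exact: bounded_measurable_lim fM fg.
have h1 := bpf_lim b1 mf fM fg; have h2 := bpf_lim b2 mf fM fg.
rewrite -(cvg_lim _ h1)// -(cvg_lim _ h2)//.
by congr (limn _); apply/funext => n /=; have [_ ->] := fP n.
Qed.

(** Measurability in the parameter survives pointwise limits; it will give the measurability of
    [s |-> mu^s(A)]. *)
Lemma bp_class_measurable (L : R -> (R -> R) -> R) (D : set R) :
  (forall s, bp_functional (L s)) -> measurable D ->
  bp_class (fun g => bounded_measurable g /\ measurable_fun D (L ^~ g)).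
Proof.
move=> bL mD; split=> [k f g [bf Lf] [bg Lg]|f_ g M fP fM fg].
  split; first exact: bounded_measurable_lin.
  under eq_fun do rewrite bpf_lin//.
  by apply: measurable_funD => //; exact: measurable_funM.
have mf n : measurable_fun [set: R] (f_ n) by have [[]] := fP n.
split; first exact: bounded_measurable_lim fM fg.
apply: (measurable_fun_cvg (h := fun n s => L s (f_ n))).
  by move=> n; have [] := fP n.
by move=> s _; exact: bpf_lim fM fg.
Qed.

Lemma bpf_eq_indic L1 L2 : bp_functional L1 -> bp_functional L2 ->
  (forall a : R, L1 \1_`]a, +oo[ = L2 \1_`]a, +oo[) ->
  forall g, bounded_measurable g -> L1 g = L2 g.
Proof.
move=> b1 b2 H g bg.
apply: (bp_bounded_measurable (bp_class_eq b1 b2) _ bg).2 => a.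
by split; [exact: bounded_measurable_indic|exact: H].
Qed.

Section integral_functional.
Context d (T : measurableType d) (m : {measure set T -> \bar R}).
Variables (X : T -> R) (w : T -> R).
Hypotheses (mX : measurable_fun setT X) (iw : m.-integrable setT (EFin \o w)).

Lemma bounded_measurable_integrable g : bounded_measurable g ->
  m.-integrable setT (EFin \o (fun t => g (X t) * w t)).
Proof.
move=> [mg [M gM]].
have mw : measurable_fun setT w by apply/measurable_EFinP; exact: measurable_int iw.
apply: (le_integrable measurableT (g := fun t => (M%:E * (w t)%:E)%E)).
- apply/measurable_EFinP; apply: measurable_funM => //.
  exact: measurableT_comp.
- move=> t _ /=; rewrite lee_fin !normrM ler_wpM2r//.
  by apply: (le_trans (gM _)); exact: ler_norm.
- exact: integrableZl.
Qed.

(** Dominated convergence with majorant [M |w|]. The weight [w] admits infinite measures [m], and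
    the variable [X] admits sums on a product space. *)
Lemma bpf_integral : bp_functional (fun g => \int[m]_t (g (X t) * w t)).
Proof.
split=> [k f g bf bg|f_ g M mf fM fg].
  rewrite -RintegralZl//; last exact: bounded_measurable_integrable.
  rewrite -RintegralD//.
  - by apply: eq_Rintegral => t _; ring.
  - exact: (integrableZl measurableT k (bounded_measurable_integrable bf)).
  - exact: bounded_measurable_integrable.
have mw : measurable_fun setT w by apply/measurable_EFinP; exact: measurable_int iw.
have bg := bounded_measurable_lim mf fM fg.
have mfw f : measurable_fun [set: R] f ->
    measurable_fun setT (EFin \o (fun t => f (X t) * w t)).
  move=> mf'; apply/measurable_EFinP; apply: measurable_funM => //.
  exact: measurableT_comp.
have [_ _ h] := @dominated_convergence _ T R m setT measurableT
  (fun n => EFin \o (fun t => f_ n (X t) * w t)) (EFin \o (fun t => g (X t) * w t))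
  (fun t => (M%:E * `|(w t)%:E|)%E)
  (fun n => mfw _ (mf n)) (mfw _ bg.1)
  ltac:(apply: aeW => t _; apply: cvg_EFin; [exact: nearW|];
        apply: cvgM; [exact: fg|exact: cvg_cst])
  ltac:(by apply: integrableZl => //; apply: integrable_abse)
  ltac:(apply: aeW => t n _ /=; rewrite lee_fin normrM ler_wpM2r//).
apply: fine_cvg; rewrite /= fineK; last first.
  by apply: integrable_fin_num => //; exact: bounded_measurable_integrable.
exact: h.
Qed.

End integral_functional.

Lemma prob_integrable_cst d (T : measurableType d) (P : probability T R) (c : R) :
  P.-integrable setT (EFin \o cst c).
Proof. exact: finite_measure_integrable_cst. Qed.

Lemma bpf_comp d (T : measurableType d) (P : probability T R) (X : T -> R) :
  measurable_fun setT X -> bp_functional (fun g => \int[P]_t g (X t)).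
Proof.
move=> mX; have := bpf_integral mX (prob_integrable_cst P 1).
by congr bp_functional; apply/funext => g; apply: eq_Rintegral => x _; rewrite mulr1.
Qed.

Lemma bpf_prob (P : probability R R) : bp_functional (fun g => \int[P]_x g x).
Proof. by have := bpf_comp P (@measurable_id _ R setT). Qed.

Lemma prob_integrable (P : probability R R) g : bounded_measurable g ->
  P.-integrable setT (EFin \o g).
Proof.
move=> bg.
have := bounded_measurable_integrable (@measurable_id _ R setT) (prob_integrable_cst P 1) bg.
by congr (integrable _ _ _); apply/funext => x /=; rewrite mulr1.
Qed.

Lemma prob_integralE (P : probability R R) g : bounded_measurable g ->
  (\int[P]_x (g x)%:E = (\int[P]_x g x)%:E)%E.
Proof.
move=> bg; rewrite /Rintegral fineK//.
by apply: integrable_fin_num => //; exact: prob_integrable.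
Qed.

Lemma prob_indicE (P : probability R R) (A : set R) : measurable A ->
  (P A = (\int[P]_x \1_A x)%:E)%E.
Proof.
move=> mA; rewrite -prob_integralE; last exact: bounded_measurable_indic.
by rewrite integral_indic// setIT.
Qed.

End bounded_pointwise_functionals.

(** * Uniqueness for characteristic functions, convolution and Laplace transforms *)

Section convolution.
Context {R : realType}.
Implicit Types (P Q S : probability R R) (f g : R -> R).

Lemma bounded_measurable_cos (t : R) : bounded_measurable (fun x => cos (t * x)).
Proof.
split; last by exists 1 => x; rewrite ler_norml cos_geN1 cos_le1.
apply: (measurableT_comp (f := cos)); first by apply: continuous_measurable_fun; exact: continuous_cos.
exact: measurable_funM.
Qed.

Lemma bounded_measurable_sin (t : R) : bounded_measurable (fun x => sin (t * x)).
Proof.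
split; last by exists 1 => x; rewrite ler_norml sin_geN1 sin_le1.
apply: (measurableT_comp (f := sin)); first by apply: continuous_measurable_fun; exact: continuous_sin.
exact: measurable_funM.
Qed.

(** The uniqueness theorem for characteristic functions, phrased for functionals so that it also
    covers the law of a sum on a product space. *)
Lemma bpf_eq_trig (L1 L2 : (R -> R) -> R) : bp_functional L1 -> bp_functional L2 ->
  (forall t, L1 (fun x => cos (t * x)) = L2 (fun x => cos (t * x))) ->
  (forall t, L1 (fun x => sin (t * x)) = L2 (fun x => sin (t * x))) ->
  forall g, bounded_measurable g -> L1 g = L2 g.
Proof.
move=> b1 b2 Hc Hs g; apply: bpf_eq_indic => // a.
apply: (trig_ray (bp_class_eq b1 b2) _ _ a).2 => t.
  by split; [exact: bounded_measurable_cos|exact: Hc].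
by split; [exact: bounded_measurable_sin|exact: Hs].
Qed.

Definition prodp P Q : probability (R * R)%type R := (P \x Q)%E.

Lemma prodpE P Q (A B : set R) : measurable A -> measurable B ->
  prodp P Q (A `*` B) = (P A * Q B)%E.
Proof. exact: product_measure1E. Qed.

Lemma bounded_measurable_prod_integrable P Q (h : R * R -> R) (M : R) :
  measurable_fun setT h -> (forall z, `|h z| <= M) ->
  (prodp P Q).-integrable setT (EFin \o h).
Proof.
move=> mh hM.
apply: (le_integrable measurableT (g := EFin \o cst M)).
- exact/measurable_EFinP.
- by move=> z _ /=; rewrite lee_fin (le_trans (hM z))// ler_norm.
- exact: (finite_measure_integrable_cst (prodp P Q) M measurableT).
Qed.

Lemma prod_bounded_measurable f g : bounded_measurable f -> bounded_measurable g ->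
  measurable_fun setT (fun z : R * R => f z.1 * g z.2) /\
  exists M : R, forall z : R * R, `|f z.1 * g z.2| <= M.
Proof.
move=> [mf [M fM]] [mg [N gN]]; split.
  apply: measurable_funM; first exact: measurableT_comp.
  exact: measurableT_comp.
by exists (M * N) => z; rewrite normrM ler_pM.
Qed.

Lemma prod_Rintegral P Q f g : bounded_measurable f -> bounded_measurable g ->
  \int[prodp P Q]_z (f z.1 * g z.2) = (\int[P]_x f x) * (\int[Q]_y g y).
Proof.
move=> bf bg; have [mh [M hM]] := prod_bounded_measurable bf bg.
have ih := bounded_measurable_prod_integrable P Q mh hM.
rewrite {1}/Rintegral -(integral12_prod_meas1 ih).
rewrite (eq_integral (fun x => (f x)%:E * (\int[Q]_y g y)%:E)%E); last first.
  move=> x _; rewrite /fubini_F /= -prob_integralE// -integralZl//.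
  exact: prob_integrable.
rewrite integralZr//; last exact: prob_integrable.
by rewrite prob_integralE.
Qed.

Definition is_convolution P Q S := forall g, bounded_measurable g ->
  \int[prodp P Q]_z g (z.1 + z.2) = \int[S]_x g x.

(** The hypotheses are the real and imaginary parts of a product of characteristic functions; the
    addition formulas identify them with the characteristic function of the sum. *)
Lemma is_convolution_cf P Q S :
  (forall t, \int[S]_x cos (t * x) = (\int[P]_x cos (t * x)) * (\int[Q]_x cos (t * x)) -
    (\int[P]_x sin (t * x)) * (\int[Q]_x sin (t * x))) ->
  (forall t, \int[S]_x sin (t * x) = (\int[P]_x sin (t * x)) * (\int[Q]_x cos (t * x)) +
    (\int[P]_x cos (t * x)) * (\int[Q]_x sin (t * x))) ->
  is_convolution P Q S.
Proof.
move=> Hc Hs.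
have mD : measurable_fun setT (fun z : R * R => z.1 + z.2).
  by apply: measurable_funD.
have bc := bounded_measurable_cos; have bs := bounded_measurable_sin.
have ip f g : bounded_measurable f -> bounded_measurable g ->
    (prodp P Q).-integrable setT (EFin \o (fun z => f z.1 * g z.2)).
  move=> bf bg; have [mh [M hM]] := prod_bounded_measurable bf bg.
  exact: bounded_measurable_prod_integrable hM.
apply: bpf_eq_trig; [exact: bpf_comp|exact: bpf_prob| |] => t.
  rewrite Hc -!prod_Rintegral// -RintegralB//;
    [|exact: (ip _ _ (bc t) (bc t))|exact: (ip _ _ (bs t) (bs t))].
  by apply: eq_Rintegral => z _; rewrite mulrDr cosD.
rewrite Hs -!prod_Rintegral// -RintegralD//;
  [|exact: (ip _ _ (bs t) (bc t))|exact: (ip _ _ (bc t) (bs t))].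
by apply: eq_Rintegral => z _; rewrite mulrDr sinD.
Qed.

(** For independent variables, the event that the first lies in [A] and the second in [B] is
    contained in the event that the sum lies in [C]. *)
Lemma convolution_le P Q S (A B C : set R) : is_convolution P Q S ->
  measurable A -> measurable B -> measurable C ->
  (forall x y, A x -> B y -> C (x + y)) -> (P A * Q B <= S C)%E.
Proof.
move=> H mA mB mC ABC.
have bA := bounded_measurable_indic mA; have bB := bounded_measurable_indic mB.
have bC := bounded_measurable_indic mC.
rewrite !prob_indicE// -EFinM lee_fin -prod_Rintegral// -H//.
have [mh [M hM]] := prod_bounded_measurable bA bB.
have mD : measurable_fun setT (fun z : R * R => z.1 + z.2).
  by apply: measurable_funD.
apply: le_Rintegral => //.
- exact: bounded_measurable_prod_integrable hM.
- case: bC => mC' [N CN].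
  apply: (@bounded_measurable_prod_integrable _ _ _ N) => //.
  exact: (measurableT_comp mC' mD).
- move=> z _; rewrite !indicE.
  have [zA|] := boolP (z.1 \in A); last by rewrite mul0r.
  have [zB|] := boolP (z.2 \in B); last by rewrite mulr0.
  rewrite mul1r mem_set//; apply: ABC; exact: set_mem.
Qed.

Definition laplace P (l : R) := \int[P]_x expR (- (l * ppart x)).

Lemma measurable_ppart : measurable_fun [set: R] (@ppart R).
Proof. exact: measurable_maxr. Qed.

Lemma expR_ppart_itv (l x : R) : 0 <= l -> 0 < expR (- (l * ppart x)) <= 1.
Proof. by move=> l0; rewrite expR_gt0 expR_le1 oppr_le0 mulr_ge0// ppart_ge0. Qed.

Lemma bounded_measurable_exp (l : R) : 0 <= l ->
  bounded_measurable (fun x => expR (- (l * ppart x))).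
Proof.
move=> l0; split; last first.
  by exists 1 => x; have /andP[? ?] := expR_ppart_itv x l0; rewrite ger0_norm// ltW.
apply: (measurableT_comp (f := expR)) => //.
under eq_fun do rewrite -mulNr.
apply: measurable_funM => //; exact: measurable_ppart.
Qed.

Lemma convolution_laplace P Q S (l : R) : is_convolution P Q S -> 0 <= l ->
  P [set x | x < 0] = 0%E -> Q [set x | x < 0] = 0%E ->
  laplace S l = laplace P l * laplace Q l.
Proof.
move=> H l0 P0 Q0; have be := bounded_measurable_exp l0.
have mneg : measurable [set x : R | x < 0].
  by rewrite (_ : mkset _ = `]-oo, 0[%classic).
have [mh [M hM]] := prod_bounded_measurable be be.
have mD : measurable_fun setT (fun z : R * R => z.1 + z.2).
  by apply: measurable_funD.
rewrite /laplace -prod_Rintegral// -H//; congr fine.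
apply: ae_eq_integral => //.
- apply/measurable_EFinP; exact: (measurableT_comp be.1 mD).
- exact/measurable_EFinP.
(* The positive part is additive when both coordinates are nonnegative; the remaining pairs form
   this null set. *)
exists ([set x | x < 0] `*` setT `|` setT `*` [set x | x < 0]); split.
- by apply: measurableU; exact: measurableX.
- apply: null_set_setU; try exact: measurableX.
  + by have := prodpE P Q mneg (@measurableT _ R); rewrite P0 mul0e.
  + by have := prodpE P Q (@measurableT _ R) mneg; rewrite Q0 mule0.
- move=> [x y] /= /not_implyP[_] nE.
  have [x0|x0] := ltP x 0; first by left.
  have [y0|y0] := ltP y 0; first by right.
  exfalso; apply: nE.
  rewrite !ppart_id ?addr_ge0// -expRD; congr (expR _)%:E; ring.
Qed.

End convolution.

(** * Averages of cosines over a uniform frequency *)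

Section sinc.
Context {R : realType}.

Definition unif01 : probability (measurableTypeR R) R := uniform_prob (@ltr01 R).

Lemma measurable_idR : measurable_fun setT (id : measurableTypeR R -> R).
Proof. by move=> _ Y mY; rewrite setTI. Qed.

Lemma bpf_unif01 : bp_functional (fun g : R -> R => \int[unif01]_t g t).
Proof. exact: bpf_comp measurable_idR. Qed.

Lemma integral_unif01_cos (y : R) : y != 0 ->
  \int[unif01]_t cos (t * y) = sin y / y.
Proof.
move=> y0.
have bc : bounded_measurable (fun t : R => cos (t * y)).
  have [mc Mc] := bounded_measurable_cos y.
  by split; [under eq_fun do rewrite mulrC|case: Mc => M Mc; exists M => t; rewrite mulrC].
have b1 := @bounded_measurable_cst R 1.
(* The added constant makes the integrand nonnegative, as [integral_uniform] requires. *)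
suff : \int[unif01]_t (1 * 1 + cos (t * y)) = 1 + sin y / y.
  rewrite (bpf_lin bpf_unif01 1 b1 bc) mul1r.
  have -> : \int[unif01]_t (1 : R) = 1; last by move=> /addrI.
  by rewrite Rintegral_cst// mul1r; exact: (congr1 fine (probability_setT unif01)).
have mf : measurable_fun setT
    (fun t : measurableTypeR R => (1 * 1 + cos ((t : R) * y))%:E).
  apply/measurable_EFinP.
  apply: (measurableT_comp (f := fun t : R => 1 * 1 + cos (t * y))) measurable_idR.
  by apply: measurable_funD => //; exact: bc.1.
rewrite /Rintegral integral_uniform => [|//|t]; last first.
  by rewrite lee_fin mul1r; have := cos_geN1 (t * y); lra.
pose F (t : R) := t + sin (t * y) / y.
have dF (t : R) : is_derive t 1 F (1 * 1 + cos (t * y)).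
  rewrite /F; apply: is_derive_eq.
  by rewrite /GRing.scale/=; field.
rewrite (@continuous_FTC2 _ _ F)//.
- by rewrite /F mul0r sin0 mul0r addr0 mul1r subr0 invr1 mul1e /= subr0.
- apply: continuous_subspaceT => t; apply: cvgD; first exact: cvg_cst.
  apply: continuous_comp; last exact: continuous_cos.
  by apply: cvgM => //; exact: cvg_cst.
- have cF : continuous F.
    by move=> t; apply: differentiable_continuous; apply/derivable1_diffP; have [] := dF t.
  split.
  + by move=> t _; have [] := dF t.
  + by apply: cvg_at_right_filter; exact: cF.
  + by apply: cvg_at_left_filter; exact: cF.
- by move=> t _; rewrite derive1E; have [_ ->] := dF t.
Qed.

Lemma prob_Rintegral_cst d (T : measurableType d) (P : probability T R) (c : R) :
  \int[P]_t c = c.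
Proof.
rewrite Rintegral_cst// -[RHS]mulr1; congr (_ * _).
exact: (congr1 fine (probability_setT P)).
Qed.

Lemma comp_integrable d (T : measurableType d) (P : probability T R) (X : T -> R) g :
  measurable_fun setT X -> bounded_measurable g ->
  P.-integrable setT (EFin \o (g \o X)).
Proof.
move=> mX bg.
have := bounded_measurable_integrable mX (prob_integrable_cst P 1) bg.
by congr (integrable _ _ _); apply/funext => x /=; rewrite mulr1.
Qed.

Lemma prob_integral_eq0 (P : probability R R) g : bounded_measurable g ->
  (forall x, 0 <= g x) -> \int[P]_x g x = 0 -> P [set x | g x != 0] = 0%E.
Proof.
move=> bg g0 ig.
have mg : measurable_fun setT (EFin \o g) by apply/measurable_EFinP; exact: bg.1.
have : (\int[P]_(x in setT) `|(EFin \o g) x| = 0)%E.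
  rewrite -[RHS]/((0 : R)%:E) -ig -prob_integralE//.
  by apply: eq_integral => x _; rewrite gee0_abs// lee_fin.
move=> /(ae_eq_integral_abs _ measurableT mg)[N [mN N0 sN]].
have mS : measurable [set x | g x != 0].
  have := bg.1 measurableT _ (measurableC (measurable_set1 (0 : R))).
  by rewrite setTI; congr measurable; apply/seteqP; split => x /= /eqP.
apply: (subset_measure0 mS mN _ N0) => x /= /eqP gx; apply: sN => /= /(_ I) h.
by apply: gx; case: h.
Qed.

End sinc.

(** * The convolution semigroup [mu^s] and its support *)

Section convolution_semigroup.
Context {R : realType}.
Implicit Types (P Q S : probability R R) (s t : R).

Lemma measurable_lt (c : R) : measurable [set x : R | x < c].
Proof. by rewrite (_ : mkset _ = `]-oo, c[%classic). Qed.

Lemma measurable_ge (c : R) : measurable [set x : R | c <= x].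
Proof.
rewrite (_ : mkset _ = `[c, +oo[%classic); first by [].
by apply/seteqP; split => x /=; rewrite in_itv/= andbT.
Qed.

Lemma convolution_neq0 P Q S (A B C : set R) : is_convolution P Q S ->
  measurable A -> measurable B -> measurable C ->
  (forall x y, A x -> B y -> C (x + y)) ->
  P A <> 0%E -> Q B <> 0%E -> S C <> 0%E.
Proof.
move=> H mA mB mC ABC PA QB SC.
have := convolution_le H mA mB mC ABC; rewrite SC => h.
have /eqP : (P A * Q B = 0)%E.
  by apply/eqP; rewrite eq_le h mule_ge0// measure_ge0.
by rewrite mule_eq0 => /orP[/eqP|/eqP].
Qed.

Lemma prob_nonneg P : P [set x | x < 0] = 0%E -> P [set x | 0 <= x] = 1%E.
Proof.
move=> P0; have := probability_setC P (measurable_lt 0); rewrite P0 sube0 => <-.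
by congr (P _); apply/seteqP; split => x /=; rewrite leNgt => /negP.
Qed.

Lemma convolution_nonneg P Q S : is_convolution P Q S ->
  P [set x | x < 0] = 0%E -> Q [set x | x < 0] = 0%E -> S [set x | x < 0] = 0%E.
Proof.
move=> H P0 Q0; have mp := measurable_ge 0.
have := convolution_le H mp mp mp (fun x y => @addr_ge0 _ x y).
rewrite (prob_nonneg P0) (prob_nonneg Q0) mule1 => h.
have -> : [set x : R | x < 0] = ~` [set x | 0 <= x].
  by apply/seteqP; split => x /=; rewrite ltNge => /negP.
rewrite probability_setC//.
have -> : S [set x | 0 <= x] = 1%E; last by rewrite subee.
by apply/eqP; rewrite eq_le h probability_le1.
Qed.

Variables (a b : R -> R) (pw : R -> probability R R).
Hypotheses (ca : continuous a) (cb : continuous b).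
Hypothesis Hpw : forall s : R, 0 <= s -> is_power a b s (pw s).

Lemma pw_cos s t : 0 <= s ->
  \int[pw s]_x cos (t * x) = expR (s * a t) * cos (s * b t).
Proof. by move=> s0; rewrite /Rintegral (Hpw s0 t).1. Qed.

Lemma pw_sin s t : 0 <= s ->
  \int[pw s]_x sin (t * x) = expR (s * a t) * sin (s * b t).
Proof. by move=> s0; rewrite /Rintegral (Hpw s0 t).2. Qed.

Lemma pw_convolution s t : 0 <= s -> 0 <= t ->
  is_convolution (pw s) (pw t) (pw (s + t)).
Proof.
move=> s0 t0; apply: is_convolution_cf => u; rewrite !pw_cos ?pw_sin ?addr_ge0//.
  by rewrite !mulrDl expRD cosD; ring.
by rewrite !mulrDl expRD sinD; ring.
Qed.

(** For cosines and sines the integral is an explicit measurable function of [s]; these generate all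
    bounded Borel functions. *)
Lemma measurable_pw g : bounded_measurable g ->
  measurable_fun [set s : R | 0 < s] (fun s => \int[pw s]_x g x).
Proof.
have mD : measurable [set s : R | 0 < s].
  rewrite (_ : mkset _ = `]0, +oo[%classic); first by [].
  by apply/seteqP; split => x /=; rewrite in_itv/= andbT.
have bQ := bp_class_measurable (fun s => bpf_prob (pw s)) mD.
have ml (c : R) : measurable_fun [set s : R | 0 < s] (fun s => s * c).
  exact: measurable_funM.
have me (c : R) : measurable_fun [set s : R | 0 < s] (fun s => expR (s * c)).
  exact: (measurableT_comp (f := expR)).
move=> bg; apply: (bp_bounded_measurable bQ _ bg).2 => c.
apply: (trig_ray bQ) => t.
- split; first exact: bounded_measurable_cos.
  have h : {in [set s : R | 0 < s], (fun s => expR (s * a t) * cos (s * b t)) =1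
      (fun s => \int[pw s]_x cos (t * x))}.
    by move=> s; rewrite inE /= => s0; rewrite pw_cos// ltW.
  apply: (eq_measurable_fun _ h).
  apply: measurable_funM => //.
  apply: (measurableT_comp (f := cos)) => //.
  by apply: continuous_measurable_fun; exact: continuous_cos.
- split; first exact: bounded_measurable_sin.
  have h : {in [set s : R | 0 < s], (fun s => expR (s * a t) * sin (s * b t)) =1
      (fun s => \int[pw s]_x sin (t * x))}.
    by move=> s; rewrite inE /= => s0; rewrite pw_sin// ltW.
  apply: (eq_measurable_fun _ h).
  apply: measurable_funM => //.
  apply: (measurableT_comp (f := sin)) => //.
  by apply: continuous_measurable_fun; exact: continuous_sin.
Qed.

(** By Fubini the left side is the [P]-mean of [sin y / y] at [y = 2 x / c], and [y >= 2] for
    [P]-almost every [x]. *)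
Lemma unif_cos_le P (c : R) : 0 < c -> P [set x | x < c] = 0%E ->
  \int[unif01]_t (\int[P]_x cos (t * (2 / c) * x)) <= 1 / 2.
Proof.
move=> c0 P0; pose d := 2 / c.
have d0 : 0 < d by rewrite divr_gt0.
pose F (z : measurableTypeR R * R) := cos ((z.1 : R) * d * z.2).
have mfst : measurable_fun setT (fun z : measurableTypeR R * R => (z.1 : R)).
  exact: (measurableT_comp measurable_idR (@measurable_fst _ _ (measurableTypeR R) R)).
have mF : measurable_fun setT F.
  apply: (measurableT_comp (f := cos)).
    by apply: continuous_measurable_fun; exact: continuous_cos.
  apply: measurable_funM => //; apply: measurable_funM => //.
have iF : (unif01 \x P)%E.-integrable setT (EFin \o F).
  apply: (@measurable_bounded_integrable _ _ _ (unif01 \x P)%E) => //.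
    have := probability_setT (unif01 \x P)%E; rewrite /= => ->.
    exact: ltry.
  exists 1; split => // M M1 z _ /=; apply: le_trans (ltW M1).
  by rewrite ler_norml cos_geN1 cos_le1.
have bu x : bounded_measurable (fun t : R => cos (t * d * x)).
  have [mc [M hM]] := bounded_measurable_cos (d * x).
  split; last by exists M => t; rewrite -mulrA mulrC.
  by under eq_fun do rewrite -mulrA mulrC.
have inner x : (\int[unif01]_t (cos (t * d * x))%:E)%E =
    (\int[unif01]_t cos (t * d * x))%:E.
  rewrite /Rintegral fineK//; apply: integrable_fin_num => //.
  exact: (comp_integrable unif01 measurable_idR (bu x)).
(* The indicator absorbs the [P]-null set [x < c], where only [cos <= 1] is used. *)
have inner_le x : \int[unif01]_t cos (t * d * x) <= 1 / 2 + \1_[set x | x < c] x.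
  rewrite indicE; have [xc|cx] := ltP x c.
    rewrite mem_set//; apply: (@le_trans _ _ 1); last by rewrite /=; lra.
    rewrite -[leRHS](prob_Rintegral_cst unif01 (1 : R)); apply: le_Rintegral => //.
    - exact: (comp_integrable unif01 measurable_idR (bu x)).
    - exact: prob_integrable_cst.
  have xc : ~ [set x : R | x < c] x by apply/negP; rewrite -leNgt.
  rewrite (memNset xc) addr0.
  have x0 : 0 < x by apply: lt_le_trans cx.
  under eq_Rintegral do rewrite -mulrA.
  have dx0 : 0 < d * x by exact: mulr_gt0.
  rewrite integral_unif01_cos ?gt_eqF//.
  rewrite ler_pdivrMr//; apply: (le_trans (sin_le1 _)).
  have : d * c <= d * x by rewrite ler_pM2l.
  by rewrite /d divfK ?gt_eqF//; lra.
have mneg := measurable_lt c.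
have bI := bounded_measurable_indic mneg.
have bh := bounded_measurable_lin 1 (bounded_measurable_cst (1 / 2)) bI.
have G_le x : (\int[unif01]_t (F (t, x))%:E <= (1 * (1 / 2) + \1_[set x | x < c] x)%:E)%E.
  by rewrite inner lee_fin mul1r.
have G_norm x : (`|\int[unif01]_t (F (t, x))%:E| <= 1)%E.
  rewrite inner lee_fin.
  apply: (le_trans (le_normr_Rintegral measurableT
    (comp_integrable unif01 measurable_idR (bu x)))).
  rewrite -[leRHS](prob_Rintegral_cst unif01 (1 : R)); apply: le_Rintegral => //.
  - exact: (integrable_norm (comp_integrable unif01 measurable_idR (bu x))).
  - exact: prob_integrable_cst.
  - by move=> t _; rewrite ler_norml cos_geN1 cos_le1.
rewrite -lee_fin.
have -> : (\int[unif01]_t (\int[P]_x cos (t * (2 / c) * x)))%:E =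
    (\int[unif01]_t \int[P]_x (F (t, x))%:E)%E.
  rewrite {1}/Rintegral fineK.
    apply: eq_integral => t _.
    by rewrite -prob_integralE//; exact: bounded_measurable_cos.
  have := integrable_fubini_F iF => /(integrable_fin_num measurableT).
  congr (_ \is a fin_num); apply: eq_integral => t _.
  by rewrite -prob_integralE//; exact: bounded_measurable_cos.
have := Fubini iF => /= ->.
apply: (@le_trans _ _ (\int[P]_x (1 * (1 / 2) + \1_[set x | x < c] x)%:E)%E).
  apply: le_integral => //.
  - apply: (le_integrable measurableT (g := EFin \o cst 1)).
    + exact: (measurable_fubini_G iF).
    + by move=> x _; rewrite /= normr1; exact: G_norm.
    + exact: prob_integrable_cst.
  - exact: (prob_integrable P bh).
rewrite (prob_integralE P bh) lee_fin (bpf_lin (bpf_prob P) _ (bounded_measurable_cst _) bI).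
have -> : \int[P]_x \1_[set x | x < c] x = 0.
  by apply: EFin_inj; rewrite -prob_indicE.
by rewrite prob_Rintegral_cst; lra.
Qed.

(** Otherwise every [mu^(r_n)] lives on [[c, oo)] and its averaged characteristic function has real
    part at most [1 / 2]; but [exp (r_n phi)] tends to 1 pointwise, so these averages tend to 1. *)
Lemma pw_close (r_ : nat -> R) (c : R) : (forall n, 0 <= r_ n) ->
  r_ @ \oo --> 0 -> 0 < c -> exists n, pw (r_ n) [set x | x < c] <> 0%E.
Proof.
move=> r0 rlim c0; apply: contrapT => /forallNP H.
have {}H n : pw (r_ n) [set x | x < c] = 0%E by apply: contrapT; exact: H.
pose f n (t : R) := expR (r_ n * a (t * (2 / c))) * cos (r_ n * b (t * (2 / c))).
have fE n t : f n t = \int[pw (r_ n)]_x cos (t * (2 / c) * x) by rewrite pw_cos.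
have ct : continuous (fun t : R => t * (2 / c)).
  by move=> t; apply: cvgM => //; exact: cvg_cst.
have cad : continuous (a \o (fun t => t * (2 / c))).
  by move=> t; apply: continuous_comp; [exact: ct|exact: ca].
have cbd : continuous (b \o (fun t => t * (2 / c))).
  by move=> t; apply: continuous_comp; [exact: ct|exact: cb].
have cf n : continuous (f n).
  move=> t; apply: cvgM.
    apply: continuous_comp; last exact: continuous_expR.
    apply: cvgM; first exact: cvg_cst.
    exact: cad.
  apply: continuous_comp; last exact: continuous_cos.
  apply: cvgM; first exact: cvg_cst.
  exact: cbd.
have f1 n t : `|f n t| <= 1.
  rewrite fE.
  have bc := bounded_measurable_cos (t * (2 / c)).
  apply: (le_trans (le_normr_Rintegral measurableT (prob_integrable _ bc))).
  rewrite -[leRHS](prob_Rintegral_cst (pw (r_ n)) (1 : R)); apply: le_Rintegral => //.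
  - exact: (integrable_norm (prob_integrable _ bc)).
  - exact: prob_integrable_cst.
  - by move=> x _; rewrite ler_norml cos_geN1 cos_le1.
have lim t : f ^~ t @ \oo --> (1 : R).
  have l0 (y : R) : (fun n => r_ n * y) @ \oo --> (0 : R).
    by have := cvgM rlim (cvg_cst y); rewrite mul0r; exact.
  rewrite -[1 : R]mulr1; apply: cvgM.
    rewrite -expR0; apply: (cvg_comp _ expR (l0 _)); exact: continuous_expR.
  rewrite -cos0; apply: (cvg_comp _ cos (l0 _)); exact: continuous_cos.
have f_le n : \int[unif01]_t f n t <= 1 / 2.
  apply: le_trans (unif_cos_le c0 (H n)); rewrite le_eqVlt; apply/orP; left.
  by apply/eqP; apply: eq_Rintegral => t _; exact: fE.
have := bpf_lim bpf_unif01 (fun n => continuous_measurable_fun (cf n)) f1 lim.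
rewrite prob_Rintegral_cst => h.
have : limn ((fun g : R -> R => \int[unif01]_t g t) \o f) <= 1 / 2.
  apply: limr_le; first by apply/cvg_ex; exists 1.
  by near=> n; exact: f_le.
by rewrite (cvg_lim _ h)//; lra.
Unshelve. all: by end_near. Qed.

Hypothesis pw1 : pw 1 [set x | x < 0] = 0%E.

Lemma pw_neg_mul s n : 0 <= s -> pw s [set x | x < 0] <> 0%E ->
  pw (n.+1%:R * s) [set x | x < 0] <> 0%E.
Proof.
move=> s0 H; elim: n => [|n IH]; first by rewrite mul1r.
rewrite -natr1 mulrDl mul1r.
apply: (convolution_neq0 (pw_convolution _ s0)) IH H => //;
  rewrite ?mulr_ge0//; try exact: measurable_lt.
by move=> x y /= x0 y0; lra.
Qed.

Lemma pw_nonneg_nat n : pw n.+1%:R [set x | x < 0] = 0%E.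
Proof.
elim: n => // n IH; rewrite -natr1.
by apply: (convolution_nonneg (pw_convolution _ _) IH pw1).
Qed.

(** If [mu^s] charged [(-oo, -c)], take a rational [q] just above [s] such that [mu^(q - s)] charges
    [(-oo, c)]. Then [mu^q] charges [(-oo, 0)], and so does [mu^(k q)] for every integer [k >= 1].
    When [k q] is an integer this is impossible. *)
Lemma pw_nonneg s : 0 < s -> pw s [set x | x < 0] = 0%E.
Proof.
move=> s0; apply: contrapT => Hs.
have [c c0 Hc] : exists2 c : R, 0 < c & pw s [set x | x < - c] <> 0%E.
  apply: contrapT => H; apply: Hs.
  apply: measure_negligible; first exact: measurable_lt.
  have -> : [set x : R | x < 0] = \bigcup_k [set x | x < - k.+1%:R^-1].
    apply/seteqP; split => x /=.
      move=> x0; exists (Num.truncn (- x)^-1) => //=.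
      rewrite ltrNr -[ltRHS]invrK ltf_pV2 ?posrE ?invr_gt0 ?oppr_gt0//.
      by rewrite truncnS_gt.
    by move=> [k _ /= xk]; apply: (lt_trans xk); rewrite oppr_lt0 invr_gt0.
  apply: negligible_bigcup => k; apply/negligibleP; first exact: measurable_lt.
  by apply: contrapT => Hk; apply: H; exists k.+1%:R^-1.
(* The least multiple of [1 / (n + 1)] strictly above [s]. *)
pose q n : R := (Num.truncn (s * n.+1%:R)).+1%:R / n.+1%:R.
have q_itv n : s < q n <= s + n.+1%:R^-1.
  have /andP[h1 h2] : (Num.truncn (s * n.+1%:R))%:R <= s * n.+1%:R < (Num.truncn (s * n.+1%:R)).+1%:R.
    by apply: truncn_itv; rewrite mulr_ge0// ltW.
  rewrite /q ltr_pdivlMr// h2/= ler_pdivrMr// mulrDl mulVf//.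
  by rewrite -natr1; lra.
have rlim : (fun n => q n - s) @ \oo --> (0 : R).
  apply: (@squeeze_cvgr _ _ _ _ (fun=> 0) (fun n => n.+1%:R^-1)).
  - by near=> n; have /andP[? ?] := q_itv n; rewrite subr_ge0 ltW//= lerBlDl.
  - exact: cvg_cst.
  - exact: cvg_harmonic.
have r0 n : 0 <= q n - s by have /andP[? _] := q_itv n; rewrite subr_ge0 ltW.
have [n Hn] := pw_close r0 rlim c0.
have := convolution_neq0 (pw_convolution (ltW s0) (r0 n)) (measurable_lt (- c))
  (measurable_lt c) (measurable_lt 0) ltac:(by move=> x y /= *; lra) Hc Hn.
rewrite addrC subrK => Hq.
have q0 : 0 <= q n by have /andP[? _] := q_itv n; rewrite ltW// (lt_trans s0).
have := @pw_neg_mul _ n q0 Hq; apply.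
by rewrite /q mulrC divfK// pw_nonneg_nat.
Unshelve. all: by end_near. Qed.

End convolution_semigroup.

(** * Laplace transforms of laws on the half-line and the Laplace exponent *)

Section laplace_exponent.
Context {R : realType}.
Implicit Types (P : probability R R) (s l u : R).

Lemma laplace_itv P l : 0 <= l -> 0 < laplace P l <= 1.
Proof.
move=> l0; have be := bounded_measurable_exp l0.
apply/andP; split; last first.
  rewrite -[leRHS](prob_Rintegral_cst P (1 : R)); apply: le_Rintegral => //.
  - exact: (prob_integrable P be).
  - exact: prob_integrable_cst.
  - by move=> x _; have /andP[] := expR_ppart_itv x l0.
rewrite lt_neqAle eq_sym; apply/andP; split; last first.
  by apply: Rintegral_ge0 => x _; exact: expR_ge0.
apply/eqP => /(prob_integral_eq0 be (fun x => expR_ge0 _)).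
rewrite (_ : [set x | _] = setT); last first.
  by apply/seteqP; split => x //= _; rewrite gt_eqF ?expR_gt0.
rewrite probability_setT => /(congr1 fine)/= /eqP.
by rewrite oner_eq0.
Qed.

Lemma laplace0 P : laplace P 0 = 1.
Proof.
rewrite /laplace -[RHS](prob_Rintegral_cst P (1 : R)).
by apply: eq_Rintegral => x _; rewrite mul0r oppr0 expR0.
Qed.

Lemma is_dirac_setC1 P (c : R) : P (~` [set c]) = 0%E -> is_dirac P.
Proof.
move=> Pc; exists c => A mA; have mc : measurable [set c] by exact: measurable_set1.
have P1 : P [set c] = 1%E.
  have := probability_setC P (measurableC mc).
  by rewrite setCK Pc sube0.
rewrite diracE; have [cA|cA] := boolP (c \in A).
  apply/eqP; rewrite eq_le probability_le1//= -P1.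
  by apply: le_measure; rewrite ?inE// => x ->; exact: set_mem.
apply: (subset_measure0 mA (measurableC mc) _ Pc) => x Ax /= xc.
by move: cA; rewrite -xc mem_set.
Qed.

(** If the value were 1, the nonnegative function [1 - exp (- l x)] would vanish almost surely, and
    [P] would be the Dirac mass at 0. *)
Lemma laplace_lt1 P l : 0 < l -> P [set x | x < 0] = 0%E -> ~ is_dirac P ->
  laplace P l < 1.
Proof.
move=> l0 P0 nd; have be := bounded_measurable_exp (ltW l0).
have b1 := @bounded_measurable_cst R 1.
have /andP[_ L1] := laplace_itv P (ltW l0).
rewrite lt_neqAle L1 andbT; apply/eqP => E; apply: nd.
pose g x := 1 - expR (- (l * ppart x)).
have bg : bounded_measurable g.
  have := bounded_measurable_lin (-1) be b1; congr bounded_measurable.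
  by apply/funext => x; rewrite /g mulN1r addrC.
have g0 x : 0 <= g x.
  by rewrite subr_ge0; have /andP[] := expR_ppart_itv x (ltW l0).
have ig : \int[P]_x g x = 0.
  rewrite (bpf_sub (bpf_prob P) b1 be) prob_Rintegral_cst -/(laplace P l) E.
  exact: subrr.
apply: (@is_dirac_setC1 P 0).
have gN0 := prob_integral_eq0 bg g0 ig.
have mS : measurable [set x | g x != 0].
  have := bg.1 measurableT _ (measurableC (measurable_set1 (0 : R))).
  by rewrite setTI; congr measurable; apply/seteqP; split => x /= /eqP.
have PN := null_set_setU (measurable_lt 0) mS P0 gN0.
apply: (subset_measure0 _ _ _ PN).
- by apply: measurableC; exact: measurable_set1.
- by apply: measurableU => //; exact: measurable_lt.
move=> x /= /eqP x0; have [xneg|xpos] := ltP x 0; [by left|right] => /=.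
rewrite /g subr_eq0 eq_sym lt_eqF// expR_lt1 oppr_lt0 mulr_gt0//.
by rewrite ppart_id// lt_neqAle eq_sym x0.
Qed.

Lemma laplace_onto P (y : R) : laplace P 1 <= y <= 1 ->
  exists2 l, 0 <= l & laplace P l = y.
Proof.
(* Squaring the argument gives a function continuous on the whole line, ready for the intermediate
   value theorem on [[0, 1]]. *)
move=> /andP[y0 y1]; pose h l := laplace P (l ^+ 2).
have ch : continuous h.
  move=> l; apply/continuous_withinNx/cvgr_dnbhsP => u [_ ul].
  apply: (bpf_lim (bpf_prob P) (f_ := fun n x => expR (- (u n ^+ 2 * ppart x)))
    (M := 1)).
  - by move=> n; exact: (bounded_measurable_exp (sqr_ge0 (u n))).1.
  - move=> n x; have /andP[? ?] := expR_ppart_itv x (sqr_ge0 (u n)).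
    by rewrite ger0_norm// ltW.
  - move=> x; apply: (cvg_comp _ expR); last exact: continuous_expR.
    by apply: cvgN; apply: cvgM; [rewrite !expr2; exact: cvgM|exact: cvg_cst].
have [//|||l _ <-] := @IVT R h 0 1 y.
- exact: continuous_subspaceT.
- by rewrite /h expr0n/= expr1n laplace0 ge_min le_max y0 y1 orbT.
by exists (l ^+ 2) => //; exact: sqr_ge0.
Qed.

(* Two values of the Laplace transform suffice: they give
   [E (exp (- X) - exp (- k)) ^ 2 = 0]. *)
Lemma laplace_dirac P (k : R) : P [set x | x < 0] = 0%E -> 0 <= k ->
  laplace P 1 = expR (- k) -> laplace P 2 = expR (- (2 * k)) -> is_dirac P.
Proof.
move=> P0 k0 L1 L2.
have b1 := bounded_measurable_exp (@ler01 R).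
have b2 := bounded_measurable_exp (ler0n R 2).
have bc := bounded_measurable_cst (expR (- (2 * k))).
pose g x := (expR (- (1 * ppart x)) - expR (- k)) ^+ 2.
have gE x : g x = (- (2 * expR (- k))) * expR (- (1 * ppart x)) +
    (1 * expR (- (2 * ppart x)) + expR (- (2 * k))).
  have e2 (y : R) : expR (- (2 * y)) = expR (- y) ^+ 2.
    by rewrite -mulrN expRM_natl.
  by rewrite /g !e2 mul1r; ring.
have b3 := bounded_measurable_lin 1 b2 bc.
have b4 := bounded_measurable_lin (- (2 * expR (- k))) b1 b3.
have bg : bounded_measurable g.
  by move: b4; congr bounded_measurable; apply/funext => x; rewrite gE.
have ig : \int[P]_x g x = 0.
  under eq_Rintegral do rewrite gE.
  rewrite (bpf_lin (bpf_prob P) _ b1 b3) (bpf_lin (bpf_prob P) _ b2 bc).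
  rewrite prob_Rintegral_cst -/(laplace P 1) -/(laplace P 2) L1 L2.
  have -> : - (2 * k) = - k + - k by ring.
  by rewrite expRD; ring.
have gN0 := prob_integral_eq0 bg (fun x => sqr_ge0 _) ig.
have mS : measurable [set x | g x != 0].
  have := bg.1 measurableT _ (measurableC (measurable_set1 (0 : R))).
  by rewrite setTI; congr measurable; apply/seteqP; split => x /= /eqP.
apply: (@is_dirac_setC1 P k).
have PN := null_set_setU (measurable_lt 0) mS P0 gN0.
apply: (subset_measure0 _ _ _ PN).
- by apply: measurableC; exact: measurable_set1.
- by apply: measurableU => //; exact: measurable_lt.
move=> x /= xk; have [xneg|xpos] := ltP x 0; [by left|right] => /=.
rewrite /g sqrf_eq0 subr_eq0; apply/eqP => /expR_inj /oppr_inj.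
by rewrite mul1r ppart_id.
Qed.

(** Cauchy's equation: nonnegativity makes [g] nondecreasing, so [m <= (n + 1) s < m + 1] yields
    [m g(1) <= (n + 1) g(s) <= (m + 1) g(1)]. *)
Lemma additive_linear (g : R -> R) : (forall s t : R, 0 < s -> 0 < t -> g (s + t) = g s + g t) ->
  (forall s, 0 < s -> 0 <= g s) -> forall s, 0 < s -> g s = s * g 1.
Proof.
move=> gD g0 s s0.
have gM n t : 0 < t -> g (n.+1%:R * t) = n.+1%:R * g t.
  move=> t0; elim: n => [|n IH]; first by rewrite !mul1r.
  by rewrite -natr1 !mulrDl !mul1r gD ?IH// mulr_gt0.
have gle x y : 0 < x -> x <= y -> g x <= g y.
  move=> x0; rewrite le_eqVlt => /predU1P[->//|xy].
  have -> : y = x + (y - x) by ring.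
  by rewrite gD ?subr_gt0// lerDl g0// subr_gt0.
have g10 := g0 1 ltr01.
have bound n : `|g s - s * g 1| <= g 1 / n.+1%:R.
  pose m := Num.truncn (s * n.+1%:R).
  have ns0 : 0 < n.+1%:R * s by rewrite mulr_gt0.
  have /andP[h1 h2] : m%:R <= s * n.+1%:R < m.+1%:R.
    by apply: truncn_itv; rewrite mulrC ltW.
  have u1 : n.+1%:R * g s <= m.+1%:R * g 1.
    by rewrite -!gM// mulr1; apply: gle => //; rewrite mulrC ltW.
  have u2 : m%:R * g 1 <= n.+1%:R * g s.
    (* Additivity is only available at positive arguments, so [m = 0] is treated separately. *)
    case: m h1 {h2 u1} => [|m] h1; first by rewrite mul0r mulr_ge0// g0.
    by rewrite -!gM// mulr1; apply: gle => //; rewrite mulrC.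
  rewrite ler_pdivlMr// -[X in _ * X](ger0_norm (ler0n R n.+1)) -normrM ler_norml.
  rewrite mulrBl; rewrite -[m.+1%:R]natr1 in u1 h2.
  have e1 : m%:R * g 1 <= s * n.+1%:R * g 1 by rewrite ler_wpM2r.
  have e2 : s * n.+1%:R * g 1 <= (m%:R + 1) * g 1 by rewrite ler_wpM2r// ltW.
  rewrite mulrDl mul1r in u1 e2.
  have -> : g s * n.+1%:R = n.+1%:R * g s by rewrite mulrC.
  have -> : s * g 1 * n.+1%:R = s * n.+1%:R * g 1 by rewrite mulrAC.
  by apply/andP; split; lra.
apply/eqP; rewrite -subr_eq0 -normr_eq0 eq_le normr_ge0 andbT.
have lim : (fun n => g 1 / n.+1%:R) @ \oo --> (0 : R).
  by have := cvgM (cvg_cst (g 1)) (@cvg_harmonic R); rewrite mulr0; exact.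
rewrite -(cvg_lim _ lim)//; apply: limr_ge; first by apply/cvg_ex; exists 0.
by near=> n; exact: bound.
Unshelve. all: by end_near. Qed.

Variables (a b : R -> R) (pw : R -> probability R R).
Hypotheses (ca : continuous a) (cb : continuous b).
Hypothesis Hpw : forall s : R, 0 <= s -> is_power a b s (pw s).
Hypothesis pw1 : pw 1 [set x | x < 0] = 0%E.

Definition psi l := - ln (laplace (pw 1) l).

(** Minus the logarithm of the left side is additive in [s] by convolution and nonnegative, hence
    linear in [s]. *)
Lemma laplace_pw s l : 0 <= l -> 0 < s -> laplace (pw s) l = expR (- (s * psi l)).
Proof.
move=> l0 s0; pose g s := - ln (laplace (pw s) l).
have Lpos t : 0 < laplace (pw t) l by have /andP[] := laplace_itv (pw t) l0.
have := @additive_linear g _ _ s s0; rewrite /g -/(psi l) => <-.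
- by rewrite opprK lnK ?posrE.
- move=> t u t0 u0.
  rewrite (convolution_laplace (pw_convolution Hpw (ltW t0) (ltW u0)) l0);
    try exact: (pw_nonneg ca cb Hpw).
  by rewrite lnM ?posrE// opprD.
- move=> t t0; rewrite oppr_ge0; apply: ln_le0.
  by have /andP[] := laplace_itv (pw t) l0.
Qed.

End laplace_exponent.

(** * Mixtures of probability laws with the atom at 0 removed *)

Section mixture.
Context {R : realType}.
Variables (k : R -> probability R R) (rho : {measure set R -> \bar R}).
Local Notation D := [set s : R | 0 < s].
Hypothesis mk : forall A : set R, measurable A -> measurable_fun D (fun s => k s A).

Lemma measurable_gt0 : measurable [set s : R | 0 < s].
Proof.
rewrite (_ : mkset _ = `]0, +oo[%classic); first by [].
by apply/seteqP; split => x /=; rewrite in_itv/= andbT.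
Qed.

Let mD := measurable_gt0.
Let mC1 (A : set R) : measurable A -> measurable (A `\ 0).
Proof. by move=> mA; apply: measurableD => //; exact: measurable_set1. Qed.

(** Countable additivity passes from each [k s] to the mixture by monotone convergence. *)
Lemma Phi_measure : exists nu : {measure set R -> \bar R},
  forall A, nu A = Phi k rho A.
Proof.
have p0 : Phi k rho set0 = 0%E.
  by rewrite /Phi integral0_eq// => s _; rewrite set0D measure0.
have pge0 A : (0 <= Phi k rho A)%E by apply: integral_ge0.
have psa : semi_sigma_additive (Phi k rho).
  move=> F mF tF _; rewrite /Phi.
  have mF0 i : measurable (F i `\ 0) by exact: mC1.
  rewrite [X in _ --> X](_ : _ =
      (\int[rho]_(s in D) \sum_(0 <= i <oo) k s (F i `\ 0%R))%E); last first.
    apply: eq_integral => s _; rewrite setD_bigcupl.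
    apply/esym/cvg_lim => //; apply: measure_sigma_additive => //.
    exact: trivIset_setIr.
  rewrite [X in X @ _](_ : _ =
      (fun n => \int[rho]_(s in D) \sum_(0 <= i < n) k s (F i `\ 0%R))%E); last first.
    apply/funext => n; rewrite ge0_integral_sum// => i.
    exact: mk.
  apply: cvg_monotone_convergence => //.
  - by move=> n; apply: emeasurable_sum => i; exact: mk.
  - by move=> n s _; rewrite sume_ge0.
  - by move=> s _ m n mn; exact: ereal_nondecreasing_series.
pose M := isMeasure.Build _ _ _ (Phi k rho) p0 pge0 psa.
pose nu : {measure set R -> \bar R} := HB.pack (Phi k rho) M.
by exists nu.
Qed.

Variable nu : {measure set R -> \bar R}.
Hypothesis Hnu : forall A, measurable A -> nu A = Phi k rho A.

Let Hnu0 (A : set R) : measurable A -> ~ A 0 ->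
  nu A = (\int[rho]_(s in D) k s A)%E.
Proof.
move=> mA A0; rewrite Hnu//; apply: eq_integral => s _; congr (k s _).
by apply/seteqP; split => x /= => [[]//|Ax]; split=> // x0; apply: A0; rewrite -x0.
Qed.

Import HBNNSimple.

Let measurable_nnsfun_integral (h : {nnsfun R >-> R}) :
  measurable_fun D (fun s => \int[k s]_x (h x)%:E)%E.
Proof.
rewrite (_ : (fun s => _) = fun s =>
    (\sum_(x \in range h) x%:E * k s (h @^-1` [set x]))%E).
  apply: emeasurable_fsum => // r; apply: measurable_funeM; apply: mk.
  exact: measurable_sfunP.
by apply/funext => s; rewrite integralT_nnsfun sintegralE.
Qed.

Let mixture_nnsfun (h : {nnsfun R >-> R}) : h 0 = 0 ->
  (\int[nu]_x (h x)%:E = \int[rho]_(s in D) \int[k s]_x (h x)%:E)%E.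
Proof.
move=> h0; rewrite integralT_nnsfun sintegralE.
under [RHS]eq_integral do rewrite integralT_nnsfun sintegralE.
rewrite ge0_integral_fsum//=; last 2 first.
- move=> r; apply: measurable_funeM; apply: mk; exact: measurable_sfunP.
- by move=> r s _; exact: nnsfun_mulemu_ge0.
apply: eq_fsbigr => r; rewrite inE => -[x _ hx].
have r0 : 0 <= r by rewrite -hx.
(* The level set of a value [r != 0] misses the point 0, because [h 0 = 0]; the removal of 0 then
   has no effect. *)
have [->|rn0] := eqVneq r 0.
  by rewrite mul0e integral0_eq// => s _; rewrite mul0e.
have mh : measurable (h @^-1` [set r]) by exact: measurable_sfunP.
rewrite ge0_integralZl_EFin//; last exact: mk.
congr (_ * _)%E; apply: Hnu0 => //= h0r.
by move/eqP: rn0; apply; rewrite -h0r.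
Qed.

(** The mixture has no mass at 0, whence the condition [f 0 = 0]. The approximating simple functions
    inherit it, and monotone convergence applies on both sides. *)
Lemma integral_mixture (f : R -> \bar R) : measurable_fun setT f ->
  (forall x, 0 <= f x)%E -> f 0 = 0%E ->
  (\int[nu]_x f x = \int[rho]_(s in D) \int[k s]_x f x)%E.
Proof.
move=> mf f0 f00.
pose g := nnsfun_approx measurableT mf.
pose gE n := EFin \o g n.
have mgE n : measurable_fun [set: R] (gE n) by exact/measurable_EFinP.
have gE_ge0 n x : (0 <= gE n x)%E by rewrite lee_fin.
have nd_gE x : {homo gE ^~ x : n m / (n <= m)%O >-> (n <= m)%E}.
  by move=> *; rewrite lee_fin; exact/lefP/nd_nnsfun_approx.
have g0 n : g n 0 = 0.
  have : ((g n 0%R)%:E <= f 0%R)%E.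
    by rewrite /g nnsfun_approxE; exact: (le_approx (D := setT) (f := f)).
  by rewrite f00 lee_fin => h; apply/eqP; rewrite eq_le h fun_ge0.
have gc x : (gE ^~ x @ \oo --> f x) by exact: (@cvg_nnsfun_approx _ _ _ _ measurableT _ mf (fun x _ => f0 x) x I).
have limE (m : {measure set R -> \bar R}) :
    (\int[m]_x gE n x @[n --> \oo] --> \int[m]_x f x)%E.
  rewrite (eq_integral (fun x => limn (gE ^~ x))); last first.
    by move=> x _; apply/esym/cvg_lim => //; exact: gc.
  exact: cvg_monotone_convergence.
have h1 := limE nu.
have h2 : (\int[rho]_(s in D) \int[k s]_x gE n x @[n --> \oo] -->
    \int[rho]_(s in D) \int[k s]_x f x)%E.
  rewrite (eq_integral (fun s => limn (fun n => \int[k s]_x gE n x)%E)); last first.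
    by move=> s _; apply/esym/cvg_lim => //; exact: limE.
  apply: cvg_monotone_convergence => //.
  - by move=> n; exact: measurable_nnsfun_integral.
  - by move=> n s _; apply: integral_ge0.
  - by move=> s _ m n mn; apply: ge0_le_integral => // x _; exact: nd_gE.
have E n : (\int[nu]_x gE n x = \int[rho]_(s in D) \int[k s]_x gE n x)%E.
  exact: mixture_nnsfun.
rewrite -(cvg_lim _ h1)// -(cvg_lim _ h2)//.
by congr (limn _); apply/funext => n; exact: E.
Qed.

End mixture.

(** * Integrability for the class [ML], and Bernstein functions *)

Section ML_measures.
Context {R : realType}.
Implicit Types (rho : {measure set R -> \bar R}) (u d : R).

Lemma integral_gt0_mkcond rho (f : R -> \bar R) :
  (forall s, s <= 0 -> f s = 0%E) ->
  (\int[rho]_(s in [set s : R | (0 < s)%R]) f s = \int[rho]_s f s)%E.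
Proof.
move=> f0; rewrite integral_mkcond; apply: eq_integral => s _.
rewrite patchE; case: ifPn => // /negP; rewrite inE /= => /negP.
by rewrite -leNgt => /f0.
Qed.

Lemma ppart_le0 (s : R) : s <= 0 -> ppart s = 0.
Proof. by move=> s0; apply/max_idPr. Qed.

Lemma ML_integrable rho (f : R -> R) (C : R) : ML rho -> measurable_fun setT f ->
  (forall s, `|f s| <= C * Num.min 1 (ppart s)) ->
  rho.-integrable setT (EFin \o f).
Proof.
move=> [_ _ Hmin] mf fC.
pose v (s : R) : R := Num.min 1 (ppart s).
have mv : measurable_fun setT v by apply: measurable_minr => //; exact: measurable_ppart.
have v0 s : 0 <= v s by rewrite le_min ler01 ppart_ge0.
have iv : rho.-integrable setT (EFin \o v).
  apply/integrableP; split; first exact/measurable_EFinP.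
  apply: le_lt_trans Hmin; rewrite [leRHS]integral_mkcond.
  rewrite le_eqVlt; apply/orP; left; apply/eqP; apply: eq_integral => s _.
  rewrite patchE; case: ifPn; rewrite ?inE /=.
    by move=> s0; rewrite ger0_norm// /v ppart_id.
  move=> /negP; rewrite inE /= => /negP; rewrite -ltNge => s0.
  by rewrite ger0_norm// /v (ppart_le0 (ltW s0)) min_r.
apply: (le_integrable measurableT (g := fun s => (C%:E * (v s)%:E)%E)).
- exact/measurable_EFinP.
- move=> s _ /=; rewrite lee_fin normrM (ger0_norm (v0 s)).
  by apply: (le_trans (fC s)); apply: ler_wpM2r; [exact: v0|exact: ler_norm].
- exact: integrableZl.
Qed.

(** From [exp (- p) <= 1 / (1 + p)] one gets [1 - exp (- p) >= p / (1 + p)], which is at least half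
    of the minimum. *)
Lemma min1_le_onemexp (p : R) : 0 <= p -> Num.min 1 p <= 2 * (1 - expR (- p)).
Proof.
move=> p0; have h1 := expR_ge1Dx p; have h2 := expRxMexpNx_1 p.
have h3 := expR_gt0 (- p).
set q := expR (- p) in h2 h3 *.
have h4 : q * (1 + p) <= 1 by nra.
by rewrite ge_min; apply/orP; have [p1|p1] := leP 1 p; [left|right]; nra.
Qed.

Lemma onemexp_le_min1 u (p : R) : 0 <= u -> 0 <= p ->
  1 - expR (- (u * p)) <= (1 + u) * Num.min 1 p.
Proof.
move=> u0 p0; have h1 := expR_ge1Dx (- (u * p)); have h2 := expR_gt0 (- (u * p)).
have up : 0 <= u * p by exact: mulr_ge0.
by have [p1|p1] := leP 1 p; nra.
Qed.

Lemma measurable_onemexp u :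
  measurable_fun [set: R] (fun s => 1 - expR (- (u * ppart s))).
Proof.
apply: measurable_funB => //; apply: (measurableT_comp (f := expR)) => //.
under eq_fun do rewrite -mulNr.
by apply: measurable_funM => //; exact: measurable_ppart.
Qed.

Lemma ML_onemexp rho u : ML rho -> 0 <= u ->
  rho.-integrable setT (EFin \o (fun s => 1 - expR (- (u * ppart s)))).
Proof.
move=> Hrho u0; apply: (ML_integrable (C := 1 + u) Hrho (measurable_onemexp u)) => s.
have /andP[_ ?] := expR_ppart_itv s u0; rewrite ger0_norm ?subr_ge0//.
exact: onemexp_le_min1 (ppart_ge0 s).
Qed.

(** For [rho] in [ML], the Bernstein function with Lévy measure [rho] and neither drift nor constant
    term. *)
Definition bernstein rho u := \int[rho]_s (1 - expR (- (u * ppart s))).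

Lemma bernsteinE rho u : ML rho -> 0 <= u ->
  (\int[rho]_s (1 - expR (- (u * ppart s)))%:E = (bernstein rho u)%:E)%E.
Proof.
move=> Hrho u0; rewrite /bernstein /Rintegral fineK//.
exact: integrable_fin_num (ML_onemexp Hrho u0).
Qed.

(* Knowing the Bernstein function on an interval [0, u0] is enough, because it
   extends analytically. *)
Lemma bernstein_inj rho1 rho2 (u0 : R) : ML rho1 -> ML rho2 -> 0 < u0 ->
  (forall u, 0 <= u <= u0 -> bernstein rho1 u = bernstein rho2 u) ->
  forall A, measurable A -> rho1 A = rho2 A.
Proof.
move=> H1 H2 u00 E A mA.
(* Half of [u0], so that [l] and [l + d] both lie in [[0, u0]] when [l <= d]. *)
pose d := u0 / 2; have d0 : 0 < d by rewrite /d; lra.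
pose w s := 1 - expR (- (d * ppart s)).
have iw rho : ML rho -> rho.-integrable setT (EFin \o w).
  by move=> Hrho; apply: ML_onemexp => //; exact: ltW.
have midR := @measurable_id _ R setT.
(* Integration against the finite measure [w rho], whose Laplace transform at [l] is the increment
   of the Bernstein function from [l] to [l + d]. *)
pose L rho g := \int[rho]_s (g s * w s).
have bL rho : ML rho -> bp_functional (L rho).
  by move=> Hrho; apply: bpf_integral => //; exact: iw.
have bQ := bp_class_eq (bL _ H1) (bL _ H2).
pose Q g := bounded_measurable g /\ L rho1 g = L rho2 g.
have Lexp rho l : ML rho -> 0 <= l ->
    L rho (fun s => expR (- (l * ppart s))) = bernstein rho (l + d) - bernstein rho l.
  move=> Hrho l0; rewrite /bernstein -RintegralB//; last 2 first.
  - by apply: ML_onemexp => //; rewrite addr_ge0// ltW.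
  - exact: ML_onemexp.
  apply: eq_Rintegral => s _; rewrite /w.
  have -> : - ((l + d) * ppart s) = - (l * ppart s) + - (d * ppart s) by ring.
  by rewrite expRD; ring.
have Qexp l : 0 <= l <= d -> has_exp Q l.
  move=> /andP[l0 ld]; split; first exact: bounded_measurable_exp.
  have du : d + d = u0 by rewrite /d; field.
  by rewrite !Lexp// !E//; apply/andP; split; lra.
have Qall := has_exp_all bQ d0 Qexp.
have Qray a : Q \1_`]a, +oo[.
  have [a0|a0] := leP 0 a; first by apply: (exp_ray bQ) => // n; exact: Qall.
  split; first exact: bounded_measurable_indic.
  have [_ Q0] := Qall 0 (lexx 0).
  (* For [a < 0] the indicator can differ from the constant 1 only where [w] vanishes. *)
  suff LE rho : L rho \1_`]a, +oo[ = L rho (fun s => expR (- (0 * ppart s))).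
    by rewrite !LE.
  apply: eq_Rintegral => s _; rewrite mul0r oppr0 expR0.
  have [s0|s0] := ltP 0 s.
    by rewrite indicE mem_set//= in_itv/= andbT (lt_trans a0).
  by rewrite /w (ppart_le0 s0) mulr0 oppr0 expR0 subrr !mulr0.
have Qall_bm g : bounded_measurable g -> Q g.
  exact: (bp_bounded_measurable bQ Qray).
pose B k := A `&` [set s : R | k.+1%:R^-1 < s].
have mgt (c : R) : measurable [set s : R | c < s].
  rewrite (_ : mkset _ = `]c, +oo[%classic); first by [].
  by apply/seteqP; split => x /=; rewrite in_itv/= andbT.
have mB k : measurable (B k) by exact: measurableI.
(* Division by [w] recovers [rho] from [w rho]: [exp (- ln w)] is [1 / w] on [B k], where [w] is
   bounded away from 0. *)
pose g k (s : R) := \1_(B k) s * expR (- ln (w s)).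
have wpos s : 0 < s -> 0 < w s.
  by move=> s0; rewrite subr_gt0 expR_lt1 oppr_lt0 mulr_gt0// ppart_id// ltW.
have kpos k : 0 < k.+1%:R^-1 :> R by rewrite invr_gt0.
have Bpos k s : B k s -> 0 < s by move=> [_ /=]; exact: lt_trans (kpos k).
have gw k s : g k s * w s = \1_(B k) s.
  rewrite /g indicE; have [Bs|] := boolP (s \in B k); last by rewrite !mul0r.
  have ws := wpos s (Bpos k s (set_mem Bs)).
  by rewrite mul1r expRN lnK ?posrE// mulVf// gt_eqF.
have bg k : bounded_measurable (g k).
  split.
    apply: measurable_funM; first exact: measurable_indic.
    apply: (measurableT_comp (f := expR)) => //.
    apply: measurableT_comp => //.
    exact: (measurableT_comp (@measurable_ln R) (measurable_onemexp d)).
  exists (w (k.+1%:R^-1))^-1 => s; rewrite /g indicE.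
  have [Bs|] := boolP (s \in B k); last first.
    by rewrite mul0r normr0 invr_ge0 ltW// wpos.
  have [_ /= ks] := set_mem Bs.
  have s0 : 0 < s by exact: lt_trans ks.
  rewrite mul1r ger0_norm ?expR_ge0// expRN lnK ?posrE ?wpos//.
  rewrite lef_pV2 ?posrE ?wpos// /w lerD2l lerN2 ler_expR lerN2.
  by rewrite ler_pM2l// !ppart_id// ltW.
have rhoB rho k : ML rho -> rho (B k) = (L rho (g k))%:E.
  move=> Hrho; rewrite /L /Rintegral fineK.
    by under eq_integral do rewrite gw; rewrite integral_indic// setIT.
  apply: integrable_fin_num => //.
  exact: (bounded_measurable_integrable midR (iw _ Hrho) (bg k)).
have Bcup : \bigcup_k B k = A `&` [set s | 0 < s].
  apply/seteqP; split => s /=.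
    by move=> [k _ Bs]; split; [case: Bs|exact: Bpos Bs].
  move=> [As s0]; exists (Num.truncn s^-1) => //; split => //=.
  by rewrite -[ltRHS]invrK ltf_pV2 ?posrE ?invr_gt0// truncnS_gt.
have ndB : nondecreasing_seq B.
  move=> m n mn; apply/subsetPset => s [As /= ms]; split => //=.
  apply: le_lt_trans ms; rewrite lef_pV2 ?posrE// ler_nat ltnS//.
have rhoA rho : ML rho -> rho A = rho (A `&` [set s | 0 < s]).
  move=> [Hneg H0 _].
  have mpos : measurable [set s : R | 0 < s] := mgt 0.
  have mneg := measurable_lt (0 : R).
  have m0 := measurable_set1 (0 : R).
  have N0 := null_set_setU mneg m0 Hneg H0.
  rewrite -[in LHS](setUIDK A [set s | 0 < s]) measureU//.
  - rewrite [X in (_ + X)%E](_ : _ = 0%E) ?adde0//.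
    apply: (subset_measure0 _ _ _ N0); [exact: measurableD|exact: measurableU|].
    move=> s [_ /= /negP]; rewrite -leNgt le_eqVlt => /predU1P[->|]; [by right|by left].
  - exact: measurableI.
  - exact: measurableD.
  - by apply/seteqP; split => s //= -[[_ ?] [_]].
rewrite !rhoA// -Bcup.
have cB rho := nondecreasing_cvg_mu (mu := rho) mB (bigcup_measurable (fun k _ => mB k)) ndB.
rewrite -(cvg_lim _ (cB rho1))// -(cvg_lim _ (cB rho2))//.
congr (limn _); apply/funext => k /=; rewrite !rhoB//.
by have [_ ->] := Qall_bm _ (bg k).
Qed.

End ML_measures.

(** * Injectivity, stability of [ML] and strictness of the inclusion for [Phi] *)

Section Phi_properties.
Context {R : realType}.
Variables (a b : R -> R) (pw : R -> probability R R).
Hypotheses (ca : continuous a) (cb : continuous b).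
Hypothesis Hpw : forall s : R, 0 <= s -> is_power a b s (pw s).
Hypothesis pw1 : pw 1 [set x | x < 0] = 0%E.
Hypothesis ndirac : ~ is_dirac (pw 1).
Local Notation D := [set s : R | 0 < s].
Implicit Types (rho nu : {measure set R -> \bar R}).
Local Notation psi := (psi pw).

Let pw_pos (s : R) : 0 < s -> pw s [set x | x < 0] = 0%E.
Proof. exact: (pw_nonneg ca cb Hpw pw1). Qed.

Let mk (A : set R) : measurable A -> measurable_fun D (fun s => pw s A).
Proof.
move=> mA; have bA := bounded_measurable_indic mA.
rewrite (_ : (fun s => _) = EFin \o (fun s => \int[pw s]_x \1_A x)); last first.
  by apply/funext => s; rewrite prob_indicE.
by apply/measurable_EFinP; exact: (measurable_pw Hpw bA).
Qed.

Let laplace_psi l : 0 <= l -> laplace (pw 1) l = expR (- psi l).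
Proof.
by move=> l0; rewrite (laplace_pw ca cb Hpw pw1 l0 ltr01) mul1r.
Qed.

Let psi_gt0 l : 0 < l -> 0 < psi l.
Proof.
move=> l0; have := laplace_lt1 l0 pw1 ndirac.
by rewrite (laplace_psi (ltW l0)) expR_lt1 oppr_lt0.
Qed.

Let psi_ge0 l : 0 <= l -> 0 <= psi l.
Proof.
move=> l0; have /andP[_] := laplace_itv (pw 1) l0.
by rewrite (laplace_psi l0) expR_le1 oppr_le0.
Qed.

Let psi_onto u : 0 <= u <= psi 1 -> exists2 l, 0 <= l & psi l = u.
Proof.
move=> /andP[u0 u1].
have [|l l0] := @laplace_onto _ (pw 1) (expR (- u)).
  by rewrite (laplace_psi ler01) ler_expR lerN2 u1 expR_le1 oppr_le0.
by rewrite (laplace_psi l0) => /expR_inj /oppr_inj; exists l.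
Qed.

(** The integrand vanishes at 0, so the mixture formula applies; the inner integral is
    [1 - exp (- s psi(l))]. *)
Let Phi_onemexp rho nu l : ML rho ->
  (forall A, measurable A -> nu A = Phi pw rho A) -> 0 <= l ->
  (\int[nu]_x (1 - expR (- (l * ppart x)))%:E = (bernstein rho (psi l))%:E)%E.
Proof.
move=> Hrho Hnu l0.
have be := bounded_measurable_exp l0.
rewrite (integral_mixture mk Hnu); last 3 first.
- apply/measurable_EFinP; exact: measurable_onemexp.
- by move=> x; rewrite lee_fin subr_ge0; have /andP[] := expR_ppart_itv x l0.
- by rewrite ppart_id// mulr0 oppr0 expR0 subrr.
rewrite -(bernsteinE Hrho (psi_ge0 l0)) -integral_gt0_mkcond; last first.
  by move=> s s0; rewrite (ppart_le0 s0) mulr0 oppr0 expR0 subrr.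
apply: eq_integral => s; rewrite inE /= => s0.
have b1 := @bounded_measurable_cst R 1.
have bg : bounded_measurable (fun x => 1 - expR (- (l * ppart x))).
  have := bounded_measurable_lin (-1) be b1; congr bounded_measurable.
  by apply/funext => x; rewrite mulN1r addrC.
rewrite prob_integralE// (bpf_sub (bpf_prob _) b1 be) prob_Rintegral_cst.
rewrite -/(laplace (pw s) l) (laplace_pw ca cb Hpw pw1 l0 s0).
by rewrite (ppart_id (ltW s0)) mulrC.
Qed.

Lemma Phi_inj rho1 rho2 : ML rho1 -> ML rho2 ->
  (forall A, measurable A -> Phi pw rho1 A = Phi pw rho2 A) ->
  forall A, measurable A -> rho1 A = rho2 A.
Proof.
move=> H1 H2 H12; have [nu nuE] := Phi_measure rho1 mk.
(* The interval of agreement is [[0, psi 1]]: it is nondegenerate since [mu] is not Dirac, and all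
   its points are values of [psi]. *)
apply: (bernstein_inj H1 H2 (psi_gt0 ltr01)) => u /psi_onto[l l0 <-].
apply: EFin_inj.
rewrite -(Phi_onemexp H1 (nu := nu)) => [|B mB|//]; last by rewrite nuE.
by rewrite -(Phi_onemexp H2 (nu := nu)) => [|B mB|//]; last by rewrite nuE H12.
Qed.

Lemma Phi_ML rho : ML rho -> exists nu, ML nu /\
  forall A, measurable A -> nu A = Phi pw rho A.
Proof.
move=> Hrho; have [nu nuE] := Phi_measure rho mk.
have Hnu A : measurable A -> nu A = Phi pw rho A by rewrite nuE.
exists nu; split=> //; split.
- rewrite nuE; apply: integral0_eq => s /= s0.
  have mneg := measurable_lt (0 : R).
  apply: (subset_measure0 _ mneg _ (pw_pos s0)); last by move=> x [].
  by apply: measurableD => //; exact: measurable_set1.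
- by rewrite nuE; apply: integral0_eq => s _; rewrite setDv measure0.
rewrite (_ : integral _ _ _ = \int[nu]_x (Num.min 1 (ppart x))%:E)%E; last first.
  rewrite integral_mkcond; apply: eq_integral => x _; rewrite patchE.
  case: ifPn; rewrite ?inE /=; first by move=> x0; rewrite ppart_id.
  move=> /negP; rewrite inE /= => /negP; rewrite -ltNge => x0.
  by rewrite (ppart_le0 (ltW x0)) min_r.
apply: (@le_lt_trans _ _ (\int[nu]_x (2%:E * (1 - expR (- (1 * ppart x)))%:E))%E).
  apply: ge0_le_integral => //.
  - by move=> x _; rewrite lee_fin le_min ler01 ppart_ge0.
  - apply/measurable_EFinP; apply: measurable_minr => //; exact: measurable_ppart.
  - apply/measurable_EFinP; apply: measurable_funM => //; exact: measurable_onemexp.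
  - by move=> x _; rewrite -EFinM lee_fin mul1r; exact: min1_le_onemexp (ppart_ge0 x).
rewrite ge0_integralZl_EFin//.
- by rewrite (Phi_onemexp Hrho Hnu ler01) -EFinM ltry.
- by move=> x _; rewrite lee_fin subr_ge0; have /andP[] := expR_ppart_itv x (@ler01 R).
- apply/measurable_EFinP; exact: measurable_onemexp.
Qed.

Let pw_half s (A B C : set R) : 0 < s -> measurable A -> measurable B -> measurable C ->
  (forall x y, A x -> B y -> C (x + y)) -> pw s C = 0%E ->
  pw (s / 2) A = 0%E \/ pw (s / 2) B = 0%E.
Proof.
move=> s0 mA mB mC ABC C0; have s2 : 0 <= s / 2 by lra.
have H := pw_convolution Hpw s2 s2.
have ss : s / 2 + s / 2 = s by field.
rewrite ss in H.
have [|A0] := eqVneq (pw (s / 2) A) 0%E; first by left.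
have [|B0] := eqVneq (pw (s / 2) B) 0%E; first by right.
exfalso; apply: (convolution_neq0 H mA mB mC ABC) C0; exact/eqP.
Qed.

Let laplace_point (P : probability R R) (c l : R) : 0 <= c -> 0 <= l ->
  P (~` [set c]) = 0%E -> laplace P l = expR (- (l * c)).
Proof.
move=> c0 l0 Pc; rewrite /laplace -[RHS](prob_Rintegral_cst P); congr fine.
have mc : measurable (~` [set c]) by apply: measurableC; exact: measurable_set1.
apply: ae_eq_integral => //.
  by apply/measurable_EFinP; exact: (bounded_measurable_exp l0).1.
exists (~` [set c]); split=> // x /= nE xc; apply: nE.
by rewrite xc ppart_id.
Qed.

(** If [mu^t] were the Dirac mass at [c], then [psi l = l c / t], and [mu] would be the Dirac mass
    at [c / t]. *)
Let pw_not_point t c : 0 < t -> 0 <= c -> pw t (~` [set c]) <> 0%E.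
Proof.
move=> t0 c0 Pc; apply: ndirac.
have psiE l : 0 <= l -> psi l = l * c / t.
  move=> l0; have := laplace_point c0 l0 Pc.
  rewrite (laplace_pw ca cb Hpw pw1 l0 t0) => /expR_inj /oppr_inj <-.
  by rewrite mulrC mulKf// gt_eqF.
have l2 : 0 <= 2 :> R by [].
apply: (laplace_dirac (k := c / t) pw1); first by rewrite divr_ge0// ltW.
  by rewrite (laplace_psi ler01) psiE// mul1r.
by rewrite (laplace_psi l2) psiE// mulrA.
Qed.

(* If [X_s] takes only the values 0 and 1, then its independent halves must
   take only the values 0 and 1/2, and cannot take both. *)
Let pw_not_two_points s : 0 < s -> pw s (~` ([set 0] `|` [set 1])) <> 0%E.
Proof.
move=> s0 Ps; pose N : set R := ~` ([set 0] `|` [set 1]).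
have m1 (x : R) : measurable [set x] by exact: measurable_set1.
have mN : measurable N by apply: measurableC; apply: measurableU.
have sub0 (C : set R) : measurable C -> C `<=` N -> pw s C = 0%E.
  by move=> mC CN; apply: (subset_measure0 mC mN CN Ps).
have t0 : 0 < s / 2 by lra.
have mgt (c : R) : measurable [set x : R | c < x].
  rewrite (_ : mkset _ = `]c, +oo[%classic); first by [].
  by apply/seteqP; split => x /=; rewrite in_itv/= andbT.
have moo (c d : R) : measurable [set x : R | c < x < d].
  rewrite (_ : mkset _ = `]c, d[%classic); first by [].
  by apply/seteqP; split => x /=; rewrite in_itv.
have P1 : pw (s / 2) [set x | 1 / 2 < x] = 0%E.
  have C0 : pw s [set x | 1 < x] = 0%E.
    apply: sub0 => // x /= x1 [] xE; rewrite xE in x1; lra.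
  by case: (pw_half s0 (mgt (1 / 2)) (mgt (1 / 2)) (mgt 1) _ C0) => // x y /= *; lra.
have P2 : pw (s / 2) [set x | 0 < x < 1 / 2] = 0%E.
  have C0 : pw s [set x | 0 < x < 1] = 0%E.
    apply: sub0 => // x /= /andP[x0 x1] [] xE; rewrite xE in x0 x1; lra.
  case: (pw_half s0 (moo 0 (1 / 2)) (moo 0 (1 / 2)) (moo 0 1) _ C0) => // x y /=.
  by move=> /andP[? ?] /andP[? ?]; apply/andP; split; lra.
have P3 := pw_pos t0.
have mneg := measurable_lt (0 : R).
have P12 := null_set_setU (mgt (1 / 2)) (moo 0 (1 / 2)) P1 P2.
have m12 : measurable ([set x : R | 1 / 2 < x] `|` [set x | 0 < x < 1 / 2]).
  exact: measurableU.
have P123 := null_set_setU m12 mneg P12 P3.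
have m123 : measurable (([set x : R | 1 / 2 < x] `|` [set x | 0 < x < 1 / 2]) `|`
    [set x | x < 0]) by exact: measurableU.
have C0 : pw s [set 1 / 2] = 0%E.
  by apply: sub0 => // x /= -> [] /= ?; lra.
have cover (x : R) : x <> 0 -> x <> 1 / 2 ->
    (([set x : R | 1 / 2 < x] `|` [set x | 0 < x < 1 / 2]) `|` [set x | x < 0]) x.
  move=> x0 x2 /=; have [xn|xp|/esym//] := ltgtP x 0; first by right.
  by left; have [_|_|//] := ltgtP x (1 / 2); [right|left].
(* The sum [0 + 1 / 2] is a forbidden value of [X_s], so one of the two atoms has mass 0 and the
   half is concentrated at the other. *)
have [Z|Z] := pw_half s0 (m1 0) (m1 (1 / 2)) (m1 (1 / 2))
  ltac:(by move=> x y /= -> ->; rewrite add0r) C0.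
- apply: (@pw_not_point (s / 2) (1 / 2)) => //.
  have mZ := measurableU _ _ m123 (m1 0).
  apply: (subset_measure0 _ mZ _ (null_set_setU m123 (m1 0) P123 Z)).
    by apply: measurableC.
  move=> x /= x2; have [->|/eqP x0] := eqVneq x 0; [by right|left].
  exact: cover.
- apply: (@pw_not_point (s / 2) 0) => //.
  have mZ := measurableU _ _ m123 (m1 (1 / 2)).
  apply: (subset_measure0 _ mZ _ (null_set_setU m123 (m1 (1 / 2)) P123 Z)).
    by apply: measurableC.
  move=> x /= x0; have [->|/eqP x2] := eqVneq x (1 / 2); [by right|left].
  exact: cover.
Qed.

Lemma ML_dirac1 : ML (\d_(1 : R) : {measure set R -> \bar R}).
Proof.
have dE (A : set R) : ~ A 1 -> (\d_(1 : R) : {measure set R -> \bar R}) A = 0%E.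
  by move=> A1; rewrite /= diracE memNset.
split.
- by apply: dE => /=; rewrite ltNge ler01.
- by apply: dE => /= /eqP; rewrite oner_eq0.
rewrite integral_dirac.
- by rewrite diracE -EFinM ltry.
- exact: measurable_ge.
- apply: measurable_funTS; apply/measurable_EFinP.
  exact: measurable_minr.
Qed.

(** Equality would make [mu^s] concentrated on [{0, 1}] for [rho]-almost every [s > 0]. No such [s]
    exists, so [rho] vanishes on [(0, oo)] and [Phi pw rho] has no mass at 1. *)
Lemma Phi_neq_dirac1 rho : ML rho ->
  ~ (forall A, measurable A -> Phi pw rho A = \d_(1 : R) A).
Proof.
move=> Hrho H; pose N : set R := ~` ([set 0] `|` [set 1]).
have m1 (x : R) : measurable [set x] by exact: measurable_set1.
have mN : measurable N by apply: measurableC; apply: measurableU.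
have NE : N `\ 0 = N.
  by apply/seteqP; split=> [x []//|x nx]; split=> // x0; apply: nx; left.
have IN : (\int[rho]_(s in D) pw s N = 0)%E.
  have := H N mN; rewrite /Phi NE => ->.
  by rewrite diracE memNset// => -[]; right.
have mD := @measurable_gt0 R.
have D0 : rho D = 0%E.
  have : (\int[rho]_(s in D) `|pw s N| = 0)%E.
    by rewrite -[RHS]IN; apply: eq_integral => s _; rewrite gee0_abs.
  move=> /(ae_eq_integral_abs rho mD (mk mN))[Z [mZ Z0 sZ]].
  apply: (subset_measure0 mD mZ _ Z0) => s /= s0; apply: sZ => /= /(_ s0).
  exact: pw_not_two_points.
have := H [set 1] (m1 1).
rewrite diracE mem_set// /Phi null_set_integral//.
  by move=> /(congr1 fine)/= /esym/eqP; rewrite oner_eq0.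
apply: mk; apply: measurableD => //.
Qed.

End Phi_properties.

(** * Identification of [mu^1] with [mu], and conclusion *)

Lemma char_exponent_power1 (R : realType) (mu P : probability R R) (a b : R -> R) :
  char_exponent mu a b -> is_power a b 1 P ->
  forall A, measurable A -> P A = mu A.
Proof.
move=> [_ _ _ _ Hmu] HP A mA; rewrite !prob_indicE//; congr EFin.
apply: (bpf_eq_trig (bpf_prob P) (bpf_prob mu)) => [t|t|].
- by rewrite /Rintegral (HP t).1 (Hmu t).1 !mul1r.
- by rewrite /Rintegral (HP t).2 (Hmu t).2 !mul1r.
exact: bounded_measurable_indic.
Qed.

Local Open Scope ereal_scope.

Theorem theorem3p3 (R : realType) (mu : probability R R)
  (a b : R -> R) (pw : R -> probability R R) :
  infinitely_divisible mu ->
  mu [set x | (x < 0)%R] = 0 ->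
  ~ is_dirac mu ->
  char_exponent mu a b ->
  (forall s : R, (0 <= s)%R -> is_power a b s (pw s)) ->
  (* Phi_mu is one-to-one on M^1_L(R^+) *)
  (forall rho1 rho2 : {measure set R -> \bar R}, ML rho1 -> ML rho2 ->
     (forall A : set R, measurable A -> Phi pw rho1 A = Phi pw rho2 A) ->
     forall A : set R, measurable A -> rho1 A = rho2 A) /\
  (* Phi_mu(M^1_L(R^+)) is contained in M^1_L(R^+) ... *)
  (forall rho : {measure set R -> \bar R}, ML rho ->
     exists nu : {measure set R -> \bar R}, ML nu /\
       forall A : set R, measurable A -> nu A = Phi pw rho A) /\
  (* ... and the inclusion is strict *)
  (exists nu : {measure set R -> \bar R}, ML nu /\
     forall rho : {measure set R -> \bar R}, ML rho ->
       ~ (forall A : set R, measurable A -> Phi pw rho A = nu A)).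
Proof.
move=> _ mu0 nd Hmu Hpw; have [ca cb _ _ _] := Hmu.
(* The support condition and nondegeneracy are transferred from [mu] to [pw 1]. *)
have pwE := char_exponent_power1 Hmu (Hpw 1%R ler01).
have pw1 : pw 1%R [set x | (x < 0)%R] = 0.
  by rewrite pwE//; exact: measurable_lt.
have npw1 : ~ is_dirac (pw 1%R).
  by move=> [c Hc]; apply: nd; exists c => A mA; rewrite -pwE// Hc.
split; [|split].
- exact: (Phi_inj ca cb Hpw pw1 npw1).
- exact: (Phi_ML ca cb Hpw pw1).
- exists \d_(1%R : R); split; first exact: ML_dirac1.
  exact: (Phi_neq_dirac1 ca cb Hpw pw1 npw1).
Qed.
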